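(* Let $\mathcal{H}$ be a complex separable infinite-dimensional Hilbert space, let $A$ be a non-zero positive bounded operator on $\mathcal{H}$ such that $R(A)$ is closed, and let $T\in\mathcal{B}_{A^{1/2}}(\mathcal{H})$. If $T$ induces a complex symmetric operator, then for every $\epsilon>0$ there exists $K\in\mathcal{K}_{A^{1/2}}(\mathcal{H})$ with $\|K\|_A<\epsilon$ such that $T+K$ induces a complex symmetric operator and $\overline{W_A(T+K)}=W_A(T+K)$.
   Context: $\mathcal{B}(\mathcal{H})$ is the algebra of bounded linear operators on $\mathcal{H}$; $A\in\mathcal{B}(\mathcal{H})$ is positive if $\langle Ax,x\rangle\ge 0$ for all $x$. $R(\cdot)$ denotes range. Put $\langle x,y\rangle_A=\langle Ax,y\rangle$ and $\|x\|_A=\langle x,x\rangle_A^{1/2}$. $\mathcal{B}_{A^{1/2}}(\mathcal{H})=\{T\in\mathcal{B}(\mathcal{H}): \exists c>0,\ \|Tx\|_A\le c\|x\|_A\ \forall x\in\mathcal{H}\}$. For such $T$, $\|T\|_A=\sup\{\|Tx\|_A/\|x\|_A: x\in\overline{R(A)},\ x\ne 0\}$ and $W_A(T)=\{\langle Tx,x\rangle_A: x\in\mathcal{H},\ \|x\|_A=1\}$ (the $A$-numerical range). $\mathcal{K}_{A^{1/2}}(\mathcal{H})$ is the set of $A$-compact operators: $K\in\mathcal{B}_{A^{1/2}}(\mathcal{H})$ is $A$-compact if for every sequence $(x_n)$ in $\mathcal{H}$ with $\sup_n\|x_n\|_A<\infty$, the sequence $(Kx_n)$ has a subsequence converging in the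 semi-norm $\|\cdot\|_A$ to an element of $\mathcal{H}$. $\mathbf{R}(A^{1/2})$ is the Hilbert space $R(A^{1/2})$ with inner product $(A^{1/2}x,A^{1/2}y)=\langle Px,Py\rangle$, where $P$ is the orthogonal projection of $\mathcal{H}$ onto $\overline{R(A)}$; $R(A)$ is dense in it and $(Ax,Ay)=\langle x,y\rangle_A$. For $T\in\mathcal{B}_{A^{1/2}}(\mathcal{H})$, $\widetilde{T}$ is the unique bounded operator on $\mathbf{R}(A^{1/2})$ with $\widetilde{T}Ax=ATx$ for all $x\in\mathcal{H}$. A bounded operator $S$ on a complex Hilbert space is complex symmetric if there is a conjugation $C$ (a conjugate-linear isometric involution) with $S=CS^*C$. $T\in\mathcal{B}_{A^{1/2}}(\mathcal{H})$ is said to induce a complex symmetric operator if $\widetilde{T}$ is a complex symmetric operator on $\mathbf{R}(A^{1/2})$. *)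

(* Defs.v *)
From HB Require Import structures.
From mathcomp Require Import all_boot all_order all_algebra.
From mathcomp Require Import complex.
From mathcomp Require Import all_classical all_reals all_analysis.

Set Implicit Arguments.
Unset Strict Implicit.
Unset Printing Implicit Defensive.

Import Order.TTheory GRing.Theory Num.Theory.
Import numFieldNormedType.Exports.

Local Open Scope classical_set_scope.
Local Open Scope ring_scope.

Section InnerProductSpace.
Context {R : realType} {V : lmodType R[i]}.

(* [ip] is linear in its first argument.  It is only a (possibly degenerate)
   semi-inner product when instantiated by [ipA] below. *)
Definition ipnorm (ip : V -> V -> R[i]) (x : V) : R :=
  Num.sqrt (complex.Re (ip x x)).

Definition bounded_op (ip : V -> V -> R[i]) (T : V -> V) : Prop :=
  exists2 c : R, 0 < c & forall x, ipnorm ip (T x) <= c * ipnorm ip x.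

Definition positive_op (ip : V -> V -> R[i]) (T : V -> V) : Prop :=
  forall x, 0 <= ip (T x) x.

Definition is_adjoint (ip : V -> V -> R[i]) (T T' : V -> V) : Prop :=
  forall x y, ip (T x) y = ip x (T' y).

Definition conjugation (ip : V -> V -> R[i]) (C : V -> V) : Prop :=
  [/\ forall (a : R[i]) x y, C (a *: x + y) = Num.conj a *: C x + C y,
      forall x, ipnorm ip (C x) = ipnorm ip x &
      involutive C].

Definition complex_symmetric (ip : V -> V -> R[i]) (T : V -> V) : Prop :=
  exists C T' : V -> V,
    [/\ conjugation ip C, is_adjoint ip T T' & forall x, T x = C (T' (C x))].

Definition infinite_dimensional : Prop :=
  forall (n : nat) (e : 'I_n -> V),
    exists x, forall c : 'I_n -> R[i], x <> \sum_(i < n) c i *: e i.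

End InnerProductSpace.
Arguments infinite_dimensional {R} V.

Definition separable (T : topologicalType) : Prop :=
  exists2 D : set T, countable D & dense D.

(* The range of a linear operator, as a vector space. *)
Section RangeSpace.
Context {K : nzRingType} {V : lmodType K}.
Implicit Types S : {linear V -> V}.

Definition range_pred S : {pred V} := fun y => `[< range S y >].

Lemma range_pred_submod_closed S : submod_closed (range_pred S).
Proof.
split=> [|a _ _ /asboolP[x _ <-] /asboolP[y _ <-]]; apply/asboolP.
  by exists 0 => //; rewrite linear0.
by exists (a *: x + y) => //; rewrite linearP.
Qed.

HB.instance Definition _ S :=
  GRing.isSubmodClosed.Build K V (range_pred S) (range_pred_submod_closed S).

Record range_space S := RangeSpace {
  range_val :> V ;
  range_valP : range_val \in range_pred S }.

HB.instance Definition _ S := [isSub for @range_val S].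
HB.instance Definition _ S := [Choice of range_space S by <:].
HB.instance Definition _ S := [SubChoice_isSubLmodule of range_space S by <:].

End RangeSpace.

Section SemiHilbertian.
Context {R : realType} {H : completeNormedModType R[i]}.
Variable dot : {dot H for (@Num.conj R[i])}.
Implicit Types (A S T K : {linear H -> H}).

Definition hilbert_dot : Prop := forall x : H, dot x x = `|x| ^+ 2.

Definition orth_proj (M : set H) (x : H) : H :=
  xget 0 [set y | M y /\ forall z, M z -> dot (x - y) z = 0].

Definition ipA A (x y : H) : R[i] := dot (A x) y.

Definition normA A : H -> R := ipnorm (ipA A).

Definition in_BA A T : Prop := bounded_op dot T /\ bounded_op (ipA A) T.

Definition opnormA A T : R :=
  sup [set normA A (T x) / normA A x |
       x in [set x | closure (range A) x /\ x != 0]].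

Definition num_rangeA A T : set (R[i] : numFieldType) :=
  [set ipA A (T x) x | x in [set x | normA A x = 1]].

Definition in_KA A K : Prop :=
  in_BA A K /\
  forall x_ : nat -> H, (exists M : R, forall n, normA A (x_ n) <= M) ->
    exists (phi : nat -> nat) (y : H),
      {homo phi : m n / (m < n)%N} /\
      normA A (K (x_ (phi n)) - y) @[n --> \oo] --> (0 : R).

Definition is_sqrt_op A S : Prop :=
  [/\ bounded_op dot S, positive_op dot S & forall x, S (S x) = A x].

Definition range_preim S (u : range_space S) : H :=
  xget 0 [set x | S x = range_val u].

(* For S the square root of A this does not depend on the chosen preimages,
   which are unique modulo ker S = ker A = (range A)^\perp. *)
Definition range_dot A S (u v : range_space S) : R[i] :=
  let P := orth_proj (closure (range A)) in
  dot (P (range_preim u)) (P (range_preim v)).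

(* The intertwining condition is phrased on the elements u of range S whose
   underlying vector is A x; they exist since A x = S (S x). *)
Definition induced_op A S T
    (Tt : {linear range_space S -> range_space S}) : Prop :=
  bounded_op (range_dot A (S := S)) Tt /\
  forall (x : H) (u : range_space S),
    range_val u = A x -> range_val (Tt u) = A (T x).

(* S (the positive square root of A) and Tt (the operator induced by T) are
   uniquely determined by the conditions imposed on them here. *)
Definition induces_complex_symmetric A T : Prop :=
  exists2 S : {linear H -> H}, is_sqrt_op A S &
  exists2 Tt : {linear range_space S -> range_space S},
    induced_op A T Tt & complex_symmetric (range_dot A (S := S)) Tt.

End SemiHilbertian.

(* Main.v *)
Require Import Defs.
From HB Require Import structures.
From mathcomp Require Import all_boot all_order all_algebra.
From mathcomp Require Import complex.
From mathcomp Require Import all_classical all_reals all_analysis.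
From mathcomp Require Import ring lra.

Set Implicit Arguments.
Unset Strict Implicit.
Unset Printing Implicit Defensive.

Import Order.TTheory GRing.Theory Num.Theory.
Import numFieldNormedType.Exports.

Local Open Scope classical_set_scope.
Local Open Scope complex_scope.
Local Open Scope ring_scope.

(* The operator T induces Tt on the Hilbert space R(A^(1/2)), and x |-> A x
   carries the semi-inner product <.,.>_A to its inner product; since R(A) is
   closed, this map is onto R(A^(1/2)).  So W_A(T) = W(Tt), and a finite-rank
   perturbation of Tt lifts to an A-compact perturbation of T with the same
   bound.

   Let W_e be the essential numerical range: the mu such that, for every finite
   set F of vectors, <Tt z, z> comes arbitrarily close to mu on unit vectors z
   orthogonal to F.  If W_e is contained in W(Tt + D), with D of finite rank,
   then W(Tt + D) is closed: along an ultrafilter, unit vectors x with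
   <(Tt + D) x, x> tending to lambda have a weak limit x0, the differences
   x - x0 are weakly null, and lambda is a convex combination of the value at
   x0 and of a point of W_e; conclude by Toeplitz-Hausdorff.

   To put W_e inside the numerical range, cover it by finitely many cells of a
   fine square grid.  Each corner l is close to W_e, hence close to <Tt e, e>
   for a unit vector e orthogonal to the vectors e', J e' chosen before, where
   J is the conjugation.  The sum D of the m (e (x) e + J e (x) J e), with
   m = (l - <Tt e, e>) / (1 + |<e, J e>|^2), satisfies J D* J = D, is small
   by orthogonality, and every corner is a value of Tt + D; by convexity the
   cells, hence W_e, lie in W(Tt + D). *)

(** * Inner products and the Toeplitz-Hausdorff theorem *)

Lemma addC_conj (R : realType) (z : R[i]) : z + z^* = (complex.Re z *+ 2)%:C.
Proof. by rewrite [LHS]addcJ rmorphMn mulr_natl. Qed.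

Section ComplexConjugation.
Context {R : realType}.
Implicit Types a b : R[i].

Lemma conjM a b : (a * b)^* = a^* * b^*. Proof. exact: rmorphM. Qed.
Lemma conjD a b : (a + b)^* = a^* + b^*. Proof. exact: rmorphD. Qed.
Lemma conjB a b : (a - b)^* = a^* - b^*. Proof. exact: rmorphB. Qed.
Lemma conjV a : (a^-1)^* = (a^*)^-1. Proof. exact: fmorphV. Qed.
Lemma conj_real (r : R) : (r%:C)^* = r%:C :> R[i]. Proof. exact: conjc_real. Qed.

End ComplexConjugation.

Section InnerProduct.
Context {R : realType} {V : lmodType R[i]}.
Variable ip : {dot V for (@Num.conj R[i])}.
Implicit Types (x y z u v : V) (a c : R[i]).

Lemma ipC x y : ip x y = (ip y x)^*.
Proof. by rewrite hermC expr0 mul1r. Qed.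

Lemma ipZl a x y : ip (a *: x) y = a * ip x y.
Proof. exact: linearZl_LR. Qed.

Lemma ipZr a x y : ip x (a *: y) = a^* * ip x y.
Proof. exact: linearZr_LR. Qed.

Lemma ipDl x y z : ip (x + y) z = ip x z + ip y z.
Proof. exact: linearDl. Qed.

Lemma ipDr x y z : ip x (y + z) = ip x y + ip x z.
Proof. exact: linearDr. Qed.

Lemma ipBl x y z : ip (x - y) z = ip x z - ip y z.
Proof. exact: linearBl. Qed.

Lemma ipBr x y z : ip x (y - z) = ip x y - ip x z.
Proof. exact: linearBr. Qed.

Lemma ip_eq0C x y : (ip x y == 0) = (ip y x == 0).
Proof. by rewrite ipC conjC_eq0. Qed.

Lemma real_ip x : (complex.Re (ip x x))%:C = ip x x.
Proof. by apply: RRe_real; apply: ger0_real; exact: dnorm_ge0. Qed.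

Lemma cauchy_schwarz x y : `|ip x y| ^+ 2 <= ip x x * ip y y.
Proof.
have [->|y0] := eqVneq y 0; first by rewrite (linear0r ip x) (linear0r ip 0) normr0 expr0n mulr0.
have yy : 0 < ip y y by rewrite dnorm_gt0.
(* The component of $x$ orthogonal to $y$ has nonnegative squared norm. *)
have := dnorm_ge0 ip (x - (ip x y / ip y y) *: y).
rewrite ipBl !ipBr !ipZl !ipZr conjM conjV.
rewrite -[(ip y y)^*]ipC -[(ip x y)^*]ipC.
have -> : ip x x - ip y x / ip y y * ip x y -
    (ip x y / ip y y * ip y x - ip x y / ip y y * (ip y x / ip y y * ip y y)) =
    (ip x x * ip y y - ip x y * ip y x) / ip y y.
  by field; rewrite gt_eqF.
by rewrite pmulr_lge0 ?invr_gt0// subr_ge0 [ip y x]ipC -normCK.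
Qed.

Lemma parallelogram x y :
  ip (x + y) (x + y) + ip (x - y) (x - y) = 2 * ip x x + 2 * ip y y.
Proof. by rewrite !(ipBl, ipBr, ipDl, ipDr); ring. Qed.

Lemma ip_sqD_le x y : ip (x + y) (x + y) <= 2 * ip x x + 2 * ip y y.
Proof. by rewrite -parallelogram lerDl dnorm_ge0. Qed.

Lemma ipnormE x : ((ipnorm ip x) ^+ 2)%:C = ip x x.
Proof.
rewrite /ipnorm sqr_sqrtr ?real_ip//.
by have := dnorm_ge0 ip x; rewrite lecE => /andP[].
Qed.

Lemma ipnorm_le (f : V -> V) (c : R) x : 0 <= c ->
  ip (f x) (f x) <= (c ^+ 2)%:C * ip x x -> ipnorm ip (f x) <= c * ipnorm ip x.
Proof.
move=> c0; rewrite -!ipnormE -rmorphM lecR -exprMn ler_pXn2r//.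
  by rewrite nnegrE sqrtr_ge0.
by rewrite nnegrE mulr_ge0// sqrtr_ge0.
Qed.

Lemma ip_le_of_bounded (f : V -> V) (c : R) x : 0 <= c ->
  ipnorm ip (f x) <= c * ipnorm ip x -> ip (f x) (f x) <= (c ^+ 2)%:C * ip x x.
Proof.
move=> c0 h; rewrite -!ipnormE -rmorphM lecR -exprMn ler_pXn2r//.
  by rewrite nnegrE sqrtr_ge0.
by rewrite nnegrE mulr_ge0// sqrtr_ge0.
Qed.

Lemma ip_le_ipnorm x y : `|ip x y| <= (ipnorm ip x * ipnorm ip y)%:C.
Proof.
rewrite -ler_sqr ?nnegrE ?normr_ge0 ?ler0c ?mulr_ge0 ?sqrtr_ge0//.
apply: (le_trans (cauchy_schwarz x y)).
by rewrite -!ipnormE -rmorphM -exprMn rmorphXn.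
Qed.

(** The constant is crude, from $2c^2+2e^2\le 4(c+e)^2$: it serves boundedness only, never
    smallness. *)
Lemma ip_sqD_bound x u v (c e : R) : 0 <= c -> 0 <= e ->
  ip u u <= (c ^+ 2)%:C * ip x x -> ip v v <= (e ^+ 2)%:C * ip x x ->
  ip (u + v) (u + v) <= ((2 * (c + e)) ^+ 2)%:C * ip x x.
Proof.
move=> c0 e0 uc ve; rewrite (le_trans (ip_sqD_le _ _))//.
apply: (@le_trans _ _ (2 * ((c ^+ 2)%:C * ip x x) + 2 * ((e ^+ 2)%:C * ip x x))).
  by rewrite lerD// ler_pM2l ?ltr0n.
rewrite !mulrA -mulrDl ler_wpM2r ?dnorm_ge0//.
rewrite -mulrDr -rmorphD -(rmorph_nat (real_complex R)) -rmorphM /= lecR.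
nra.
Qed.

Definition num_range (B : V -> V) : set R[i] :=
  [set w | exists2 x, ip x x = 1 & ip (B x) x = w].

Lemma num_range_homogeneous (B : {linear V -> V}) z w :
  z != 0 -> ip (B z) z = w * ip z z -> num_range B w.
Proof.
move=> z0 h; have zz : 0 < ip z z by rewrite dnorm_gt0.
set k : R[i] := sqrtC (ip z z); have k0 : 0 < k by rewrite sqrtC_gt0.
have kc : (k^-1)^* = k^-1.
  by apply: (@CrealP _ _ _); apply: ger0_real; rewrite invr_ge0 ltW.
have kk : k ^+ 2 = ip z z by rewrite sqrtCK.
have kn0 := lt0r_neq0 k0.
exists (k^-1 *: z); first by rewrite ipZl ipZr kc -kk; field.
by rewrite [B _]linearZ/= ipZl ipZr kc h -kk; field.
Qed.

(* Rotating the second vector makes the mixed terms of the form real, so that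
   the intermediate value theorem applies along a segment. *)
Lemma unimodular_real (p r : R[i]) :
  exists2 c : R[i], c^* * c = 1 & exists q : R, c^* * p + c * r = q%:C.
Proof.
(* Since $\bar c p+cr=2\,\mathrm{Re}(\bar c p)+cw$, it suffices that $cw$ be real; $c=\bar w/|w|$
   gives $cw=|w|$. *)
pose w : R[i] := r - p^*.
have [w0|w0] := eqVneq w 0.
  exists 1; first by rewrite rmorph1 mulr1.
  exists (complex.Re p *+ 2).
  rewrite rmorph1 !mul1r; move: w0 => /eqP; rewrite subr_eq0 => /eqP ->.
  by rewrite addC_conj.
have nw : `|w| != 0 by rewrite normr_eq0.
have nwc : (`|w|)^* = `|w| by exact/CrealP/normr_real.
have ww : `|w| ^+ 2 = w * w^* by rewrite normCK.
exists (w^* / `|w|).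
  by rewrite conjM conjV conjCK nwc mulrACA -invfM -ww expr2 divff// mulf_neq0.
set c : R[i] := w^* / `|w|.
have -> : r = w + p^* by rewrite /w subrK.
have cw : c * w = `|w| by rewrite /c mulrAC [_ * w]mulrC -ww expr2 mulfK.
have [n hn] : exists n, `|w| = n%:C by apply/complex_realP/normr_real.
exists (complex.Re (c^* * p) *+ 2 + n).
rewrite rmorphD/= -addC_conj -hn -cw; clearbody c.
by rewrite conjM conjCK mulrDr; ring.
Qed.

(** For $z_t=(1-t)x+tcy$ with a suitable unimodular $c$, both $\langle z_t,z_t\rangle$ and $(\langle
    Bz_t,z_t\rangle-w_1\langle z_t,z_t\rangle)/(w_2-w_1)$ are real quadratic polynomials in $t$. The
    intermediate value theorem yields a $t$ at which the second is $s$ times the first. *)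
Theorem toeplitz_hausdorff (B : {linear V -> V}) (w1 w2 : R[i]) (s : R) :
  num_range B w1 -> num_range B w2 -> 0 <= s <= 1 ->
  num_range B ((1 - s%:C) * w1 + s%:C * w2).
Proof.
move=> [x x1 hx] [y y1 hy] /andP[s0 s1].
have [w12|w12] := eqVneq w1 w2.
  by exists x => //; rewrite hx -w12; ring.
pose d : R[i] := w2 - w1; have d0 : d != 0 by rewrite subr_eq0 eq_sym.
have [c cc [q hq]] := unimodular_real ((ip (B x) y - w1 * ip x y) / d)
  ((ip (B y) x - w1 * ip y x) / d).
pose m : R := complex.Re (c^* * ip x y) *+ 2.
have hm : m%:C = c^* * ip x y + c * ip y x.
  rewrite /m -addC_conj; congr (_ + _).
  by rewrite conjM conjCK [ip y x]ipC.
(* The normalised form at $z_t$ minus $s$ times the squared norm; $h(0)=-s\le 0\le 1-s=h(1)$. *)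
pose h : {poly R} := 'X ^+ 2 + q *: ('X * (1 - 'X))
  - s *: ((1 - 'X) ^+ 2 + 'X ^+ 2 + m *: ('X * (1 - 'X))).
have hh t : h.[t] = t ^+ 2 + q * (t * (1 - t))
    - s * ((1 - t) ^+ 2 + t ^+ 2 + m * (t * (1 - t))).
  by rewrite /h !hornerE.
have [||t _ /rootP] := @poly_ivt R h 0 1; first exact: ler01.
  by rewrite !hh; apply/andP; split; lra.
rewrite hh => ht; pose tc : R[i] := t%:C.
have tcc : tc^* = tc by exact: conj_real.
have tcc1 : (1 - tc)^* = 1 - tc by rewrite conjB rmorph1 tcc.
pose z := (1 - tc) *: x + (tc * c) *: y.
have zz : ip z z = (1 - tc) ^+ 2 + tc ^+ 2 + m%:C * (tc * (1 - tc)).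
  rewrite /z ipDl !ipDr !ipZl !ipZr x1 y1 hm conjM tcc tcc1.
  transitivity ((1 - tc) ^+ 2 + (c^* * c) * tc ^+ 2 +
    (c^* * ip x y + c * ip y x) * (tc * (1 - tc))); first by ring.
  by rewrite cc; ring.
have Bzz : ip (B z) z - w1 * ip z z = d * (tc ^+ 2 + q%:C * (tc * (1 - tc))).
  have -> : B z = (1 - tc) *: B x + (tc * c) *: B y.
    by rewrite /z linearD !linearZ.
  rewrite -hq /z !ipDl !ipDr !ipZl !ipZr.
  rewrite x1 y1 hx hy conjM tcc tcc1.
  transitivity ((c^* * c) * tc ^+ 2 * d +
    (tc * (1 - tc)) * (c^* * (ip (B x) y - w1 * ip x y)
      + c * (ip (B y) x - w1 * ip y x))).
    by rewrite /d; ring.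
  by rewrite cc; field.
have key : tc ^+ 2 + q%:C * (tc * (1 - tc)) = s%:C * ip z z.
  rewrite zz /tc; apply/eqP; rewrite -subr_eq0; apply/eqP.
  by have := congr1 (fun r : R => r%:C) ht; rewrite !(rmorphB, rmorphD, rmorphM, rmorphXn, rmorph1, rmorph0).
(* If $z$ vanished, $y$ would be a unimodular multiple of $x$, forcing $w_1=w_2$. *)
have z0 : z != 0.
  apply/eqP => z0.
  have t0 : tc != 0.
    apply/eqP => t0; move: z0; rewrite /z t0 subr0 scale1r mul0r scale0r addr0.
    by move=> x0; move: x1; rewrite x0 linear0l => /eqP; rewrite eq_sym oner_eq0.
  have c0 : c != 0.
    by apply/eqP => c0; move: cc; rewrite c0 mulr0 => /eqP; rewrite eq_sym oner_eq0.
  have tc0 : tc * c != 0 by rewrite mulf_neq0.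
  pose k : R[i] := - ((tc * c)^-1 * (1 - tc)).
  have yk : y = k *: x.
    rewrite /k scaleNr -scalerA; move/eqP: z0; rewrite /z addrC addr_eq0 => /eqP z0.
    by apply: (scalerI tc0); rewrite z0 scalerN scalerKV ?unitfE.
  have kk : k * k^* = 1.
    by move: y1; rewrite yk ipZl ipZr x1 mulr1.
  by move: hy; rewrite yk [B _]linearZ/= ipZl ipZr hx mulrA kk mul1r => /eqP; apply/negP.
apply: (num_range_homogeneous z0).
have -> : ip (B z) z = w1 * ip z z + d * (s%:C * ip z z).
  by rewrite -key -Bzz addrC subrK.
by rewrite /d; ring.
Qed.

End InnerProduct.

(** * Ultrafilters and weak limits *)

Section ComplexLimits.
Context {R : realType} {T : Type} (F : set_system T) {FF : Filter F}.
Implicit Types (f g : T -> (R[i] : numFieldType)) (l : R[i]).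

Lemma gt0C (e : R[i]) : 0 < e -> exists2 r : R, 0 < r & e = r%:C.
Proof.
rewrite ltcE => /andP[/eqP ie re]; exists (complex.Re e) => //.
by case: e ie {re} => a b /= ->.
Qed.

Lemma cvgC_ext f g l m : f @ F --> (l : (R[i] : numFieldType)) ->
  f =1 g -> l = m -> g @ F --> (m : (R[i] : numFieldType)).
Proof. by move=> h /funext <- <-. Qed.

Lemma norm_le_Re_Im (a b : R) : `|a +i* b| <= (`|a| + `|b|)%:C.
Proof.
have -> : a +i* b = a%:C + 'i * b%:C by rewrite [LHS]complexE/= complexiE.
rewrite (le_trans (ler_normD _ _))// normrM normCi mul1r.
by rewrite !normc_def/= !expr0n/= !addr0 !sqrtr_sqr rmorphD.
Qed.

Lemma cvgC_Re f l : f @ F --> (l : (R[i] : numFieldType)) ->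
  complex.Re (f x) @[x --> F] --> complex.Re l.
Proof.
move=> /cvgrPdist_lt h; apply/cvgrPdist_lt => e e0.
have := h e%:C; rewrite ltcR => /(_ e0); apply: filterS => x.
move=> /(le_lt_trans (normc_ge_Re _)); rewrite ltcR raddfB.
exact.
Qed.

Lemma cvgC_conj f l : f @ F --> (l : (R[i] : numFieldType)) ->
  ((f x)^* : (R[i] : numFieldType)) @[x --> F] --> (l^* : (R[i] : numFieldType)).
Proof.
move=> /cvgrPdist_lt h; apply/cvgrPdist_lt => e e0.
by apply: filterS (h e e0) => x; rewrite -conjB norm_conjC.
Qed.

Lemma cvgC_Re_Im f (a b : R) :
  complex.Re (f x) @[x --> F] --> a -> complex.Im (f x) @[x --> F] --> b ->
  f @ F --> (a +i* b : (R[i] : numFieldType)).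
Proof.
move=> /cvgrPdist_lt ha /cvgrPdist_lt hb; apply/cvgrPdist_lt => e /gt0C[r r0 ->].
have r2 : 0 < r / 2 by rewrite divr_gt0.
apply: filterS2 (ha _ r2) (hb _ r2) => x.
case: (f x) => c d /= hc hd.
by rewrite (le_lt_trans (norm_le_Re_Im _ _))// ltcR; lra.
Qed.

Lemma cvgC_unique {PF : ProperFilter F} f l m :
  f @ F --> (l : (R[i] : numFieldType)) -> f @ F --> (m : (R[i] : numFieldType)) ->
  l = m.
Proof. move=> hl hm; exact: (cvg_unique _ hl hm). Qed.

End ComplexLimits.

(** Being fixed by conjugation passes to the limit, so [l] is real and it remains to compare real
    parts. *)
Lemma cvgC_ge0 {R : realType} {T : Type} (F : set_system T) {FF : ProperFilter F}
  (f : T -> (R[i] : numFieldType)) (l : R[i]) :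
  f @ F --> (l : (R[i] : numFieldType)) -> (forall x, 0 <= f x) -> 0 <= l.
Proof.
move=> fl f0.
have lr : (complex.Re l)%:C = l.
  apply: RRe_real; apply/CrealP; apply: (cvgC_unique (F := F) _ fl).
  have -> : f = fun x => (f x)^*.
    by apply/funext => x; have /CrealP -> := ger0_real (f0 x).
  exact: cvgC_conj.
rewrite -lr lecR.
apply: (cvgr_to_ge (cvgC_Re fl)).
by apply: nearW => x; have := f0 x; rewrite lecE => /andP[].
Qed.

Lemma fmap_ultra (S T : Type) (f : S -> T) (U : set_system S) :
  UltraFilter U -> UltraFilter (f @ U).
Proof.
move=> UU; split; first exact: fmap_proper_filter.
move=> G PG UG; apply/seteqP; split=> [A GA|]; last exact: UG.
have [//|UnA] := in_ultra_setVsetC (f @^-1` A) UU.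
have GnA : G (~` A) by exact: UG.
by have [x []] := filter_ex (filterI GA GnA).
Qed.

(** Compactness of $[-M,M]$ is applied to the real and imaginary parts separately, whence the factor
    2. *)
Lemma ultra_cvgC {R : realType} {T : Type} (U : set_system T) {UU : UltraFilter U}
  (f : T -> (R[i] : numFieldType)) (M : R) : 0 <= M ->
  U [set x | `|f x| ^+ 2 <= (M ^+ 2)%:C] ->
  exists2 l : R[i], f @ U --> (l : (R[i] : numFieldType)) &
    `|l| ^+ 2 <= (2 * M ^+ 2)%:C.
Proof.
move=> M0 fM; have PU : ProperFilter U by exact: ultra_proper.
have lim (g : T -> R) : U [set x | `|g x| <= M] ->
    exists2 a, `|a| <= M & g @ U --> a.
  move=> gM; have := @segment_compact R (- M) M; rewrite compact_ultra => cpt.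
  have [||a [aM ga]] := cpt (g @ U).
  - exact: fmap_ultra.
  - suff : U (g @^-1` `[- M, M]) by [].
    by apply: (filterS _ gM) => x /= gx; rewrite in_itv/= -ler_norml.
  - by exists a => //; move: aM; rewrite /= in_itv/= ler_norml.
have nle (a b : R) : `|a +i* b| ^+ 2 <= (M ^+ 2)%:C -> `|a| <= M /\ `|b| <= M.
  rewrite -add_Re2_Im2 lecR/= => h.
  by split; rewrite -(ler_pXn2r (n := 2))// ?nnegrE// real_normK ?num_real//;
    apply: le_trans h; rewrite ?lerDl ?lerDr sqr_ge0.
have [a aM ha] : exists2 a, `|a| <= M & complex.Re (f x) @[x --> U] --> a.
  by apply: lim; apply: (filterS _ fM) => x /=; case: (f x) => c d /nle[].
have [b bM hb] : exists2 b, `|b| <= M & complex.Im (f x) @[x --> U] --> b.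
  by apply: lim; apply: (filterS _ fM) => x /=; case: (f x) => c d /nle[].
exists (a +i* b); first exact: cvgC_Re_Im.
rewrite -add_Re2_Im2 lecR/= -(real_normK (num_real a)) -(real_normK (num_real b)).
by rewrite mulr2n mulrDl mul1r lerD// ler_pXn2r ?nnegrE.
Qed.

Section WeakLimit.
Context {R : realType} {V : lmodType R[i]}.
Variable ip : {dot V for (@Num.conj R[i])}.
Implicit Types (x y z u v : V).

(* Stands in for completeness of V. *)
Definition riesz_property := forall phi : V -> R[i],
  (forall a x y, phi (a *: x + y) = a * phi x + phi y) ->
  forall c : R, (forall x, `|phi x| ^+ 2 <= c%:C * ip x x) ->
  exists w, forall x, phi x = ip x w.

(** For each $y$ the bounded numbers $\langle y,x\rangle$ converge along [U]; the limits form a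
    bounded linear functional of $y$, whose Riesz vector is [x0]. *)
Lemma weak_limit (U : set_system V) {UU : UltraFilter U} : riesz_property ->
  U [set x | ip x x = 1] -> exists x0, forall y,
    (ip y x : (R[i] : numFieldType)) @[x --> U] --> (ip y x0 : (R[i] : numFieldType)).
Proof.
move=> riesz U1; have PU : ProperFilter U by exact: ultra_proper.
have ex y : exists l : R[i],
    (ip y x : (R[i] : numFieldType)) @[x --> U] --> (l : (R[i] : numFieldType)) /\
    `|l| ^+ 2 <= 2%:C * ip y y.
  have [||l yl lM] := @ultra_cvgC R V U UU (fun x => ip y x) (ipnorm ip y).
  - exact: sqrtr_ge0.
  - apply: (filterS _ U1) => x /= x1; rewrite ipnormE.
    by have := cauchy_schwarz ip y x; rewrite x1 mulr1.
  - by exists l; split=> //; move: lM; rewrite rmorphM/= ipnormE.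
have [phi hphi] := choice ex.
have [a x y||w hw] := riesz phi _ 2.
- apply: (cvgC_unique (F := U) (hphi _).1).
  have -> : (fun z => ip (a *: x + y) z : (R[i] : numFieldType))
      = (fun z => a * ip x z + ip y z).
    by apply/funext => z; rewrite ipDl ipZl.
  apply: cvgD (hphi y).1; apply: cvgM (hphi x).1; exact: cvg_cst.
- by move=> x; exact: (hphi x).2.
- by exists w => y; rewrite -hw; exact: (hphi y).1.
Qed.

End WeakLimit.

(** * The essential numerical range *)

Section EssentialNumericalRange.
Context {R : realType} {V : lmodType R[i]}.
Variable ip : {dot V for (@Num.conj R[i])}.
Implicit Types (x y z u v f g : V) (F G : seq V).

Definition orthonormal_seq G :=
  pairwise (fun u v => ip u v == 0) G /\ (forall g, g \in G -> ip g g = 1).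

Lemma orthonormal_cons g G : orthonormal_seq (g :: G) ->
  [/\ ip g g = 1, forall h, h \in G -> ip g h = 0 & orthonormal_seq G].
Proof.
move=> [/=/andP[/allP og oG] uG]; split.
- by apply: uG; rewrite mem_head.
- by move=> h /og/eqP.
- by split=> // h hG; apply: uG; rewrite in_cons hG orbT.
Qed.

(** Here [f'] is the component of [f] orthogonal to [G]. That [f - f'] lies in the span of [G] is
    expressed dually: vectors orthogonal to [G] do not separate [f] from [f']. *)
Lemma orth_projection G f : orthonormal_seq G -> exists f',
  (forall g, g \in G -> ip f' g = 0) /\
  (forall z, (forall g, g \in G -> ip z g = 0) -> ip z f' = ip z f).
Proof.
elim: G => [_|g G IH /orthonormal_cons[g1 og /IH[f' [f'G zf']]]]; first by exists f.
exists (f' - ip f' g *: g); split=> [h|z zG].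
  rewrite in_cons ipBl ipZl => /predU1P[->|hG]; first by rewrite g1 mulr1 subrr.
  by rewrite (f'G h)// og// mulr0 subr0.
rewrite ipBr ipZr (zG g) ?mem_head// mulr0 subr0 zf'// => h hG.
by rewrite zG// in_cons hG orbT.
Qed.

Lemma gram_schmidt F : exists2 G, orthonormal_seq G &
  forall z, (forall g, g \in G -> ip z g = 0) -> forall f, f \in F -> ip z f = 0.
Proof.
elim: F => [|f F [G oG GF]]; first by exists [::].
have [f' [f'G zf']] := orth_projection f oG.
have [f'0|f'0] := eqVneq f' 0.
  exists G => // z zG h; rewrite in_cons => /predU1P[->|]; last exact: GF.
  by rewrite -zf'// f'0 linear0r.
pose k := sqrtC (ip f' f').
have k0 : k != 0 by rewrite sqrtC_eq0 dnorm_eq0.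
have kc : (k^-1)^* = k^-1.
  by apply/CrealP/ger0_real; rewrite invr_ge0 sqrtC_ge0 dnorm_ge0.
have kk : ip f' f' = k ^+ 2 by rewrite sqrtCK.
exists (k^-1 *: f' :: G).
  case: oG => oG uG; split=> [/=|g].
    rewrite oG andbT; apply/allP => g gG.
    by rewrite ipZl f'G// mulr0.
  rewrite in_cons => /predU1P[->|]; last exact: uG.
  by rewrite ipZl ipZr kc kk; field.
move=> z zG.
have zG' g : g \in G -> ip z g = 0 by move=> gG; apply: zG; rewrite in_cons gG orbT.
move=> h; rewrite in_cons => /predU1P[->|]; last exact: GF.
have := zG _ (mem_head _ _); rewrite ipZr kc zf'// => /eqP.
by rewrite mulf_eq0 invr_eq0 (negPf k0) => /eqP.
Qed.

(** The formulation by finite sets, rather than by weakly null sequences, makes invariance under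
    operators of the form [diag_op] immediate: their vectors are added to [F]. *)
Definition ess_num_range (B : V -> V) : set R[i] :=
  [set mu | forall F (e : R), 0 < e -> exists z,
    [/\ ip z z = 1, forall f, f \in F -> ip z f = 0 &
        `|ip (B z) z - mu| < e%:C]].

Notation C := (R[i] : numFieldType).

(** The components along [G] are removed one at a time. The coefficients $\langle Z,g\rangle$ tend
    to 0, and so do $\langle BZ,g\rangle=\langle Z,B'g\rangle$, so the limits [a] and [s] do not
    change. *)
Lemma orthogonalize_weakly_null (U : set_system V) {PU : ProperFilter U}
    (B : {linear V -> V}) (B' : V -> V) G (a s : R[i]) (Z : V -> V) :
  is_adjoint ip B B' -> orthonormal_seq G ->
  (forall y, (ip (Z x) y : C) @[x --> U] --> (0 : C)) ->
  (ip (B (Z x)) (Z x) : C) @[x --> U] --> (a : C) ->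
  (ip (Z x) (Z x) : C) @[x --> U] --> (s : C) ->
  exists Z' : V -> V,
    [/\ forall x g, g \in G -> ip (Z' x) g = 0,
        forall y, (ip (Z' x) y : C) @[x --> U] --> (0 : C),
        (ip (B (Z' x)) (Z' x) : C) @[x --> U] --> (a : C) &
        (ip (Z' x) (Z' x) : C) @[x --> U] --> (s : C)].
Proof.
move=> adj oG Z0 Za Zs.
elim: G oG => [_|g G IH]; first by exists Z.
move=> /orthonormal_cons[g1 og /IH[{Z0 Za Zs}Z [ZG Z0 Za Zs]]].
have Z0c y : (ip y (Z x) : C) @[x --> U] --> (0 : C).
  apply: (cvgC_ext (cvgC_conj (Z0 y))) => [x|]; last exact: conjC0.
  by rewrite -ipC.
have Zgc : ((ip (Z x) g)^* : C) @[x --> U] --> (0 : C).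
  by apply: (cvgC_ext (cvgC_conj (Z0 g))) => //; exact: conjC0.
exists (fun x => Z x - ip (Z x) g *: g); split.
- move=> x h; rewrite in_cons ipBl ipZl => /predU1P[->|hG].
    by rewrite g1 mulr1 subrr.
  by rewrite (ZG x h)// og// mulr0 subr0.
- move=> y; apply: (cvgC_ext (cvgB (Z0 y) (cvgM (Z0 g) (cvg_cst (ip g y : C))))).
    by move=> x; rewrite !fctE/= ipBl ipZl.
  by rewrite mul0r subr0.
- apply: (cvgC_ext (cvgB (cvgB Za (cvgM (Z0 g) (Z0c (B g))))
    (cvgB (cvgM Zgc (Z0 (B' g)))
      (cvgM Zgc (cvgM (Z0 g) (cvg_cst (ip (B g) g : C))))))) => [x /=|].
    rewrite !fctE [B (_ - _)]linearB [B (_ *: g)]linearZ/= ipBr ipZr !ipBl !ipZl.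
    by rewrite -adj; ring.
  by rewrite !mul0r !subr0.
- apply: (cvgC_ext (cvgB (cvgB Zs (cvgM (Z0 g) (Z0c g))) (cvgB (cvgM Zgc (Z0 g))
    (cvgM Zgc (cvgM (Z0 g) (cvg_cst (ip g g : C))))))) => [x /=|].
    by rewrite !fctE/= ipBr ipZr !ipBl !ipZl; ring.
  by rewrite !mul0r !subr0.
Qed.

(** Given [F], the family [Z] is made orthogonal to it; a member far enough along [U] is then
    nonzero, as $s\ne 0$, and is normalised. *)
Lemma ess_num_range_weakly_null (U : set_system V) {PU : ProperFilter U}
    (B : {linear V -> V}) (B' : V -> V) (a s : R[i]) (Z : V -> V) :
  is_adjoint ip B B' -> s != 0 ->
  (forall y, (ip (Z x) y : C) @[x --> U] --> (0 : C)) ->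
  (ip (B (Z x)) (Z x) : C) @[x --> U] --> (a : C) ->
  (ip (Z x) (Z x) : C) @[x --> U] --> (s : C) ->
  ess_num_range B (a / s).
Proof.
move=> adj s0 Z0 Za Zs F e e0.
have [G oG GF] := gram_schmidt F.
have [{Z0 Za Zs}Z [ZG _ Za Zs]] := orthogonalize_weakly_null adj oG Z0 Za Zs.
have Zas : (ip (B (Z x)) (Z x) / ip (Z x) (Z x) : C) @[x --> U] --> (a / s : C).
  by apply: cvgM Za _; exact: cvgV.
have /cvgrPdist_lt/(_ e%:C) := Zas; rewrite ltcR => /(_ e0) Ze.
have /cvgr_neq0/(_ s0) Zn := Zs.
have [x [xe xn]] := filter_ex (filterI Ze Zn).
have Zx0 : Z x != 0 by rewrite -(dnorm_eq0 ip).
pose k := sqrtC (ip (Z x) (Z x)).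
have k0 : k != 0 by rewrite sqrtC_eq0.
have kc : (k^-1)^* = k^-1.
  by apply/CrealP/ger0_real; rewrite invr_ge0 sqrtC_ge0 dnorm_ge0.
have kk : ip (Z x) (Z x) = k ^+ 2 by rewrite sqrtCK.
exists (k^-1 *: Z x); split.
- by rewrite ipZl ipZr kc kk; field.
- by move=> f fF; rewrite ipZl (GF (Z x))// ?mulr0// => g gG; exact: ZG.
- rewrite [B _]linearZ/= ipZl ipZr kc distrC.
  move: xe; rewrite /= kk; congr (`|_ - _| < _).
  by field.
Qed.

Theorem closed_num_range (B : {linear V -> V}) (B' : V -> V) (c : R) :
  riesz_property ip -> 0 < c ->
  (forall x, ip (B x) (B x) <= (c ^+ 2)%:C * ip x x) -> is_adjoint ip B B' ->
  ess_num_range B `<=` num_range ip B ->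
  closure (num_range ip B : set C) `<=` num_range ip B.
Proof.
move=> riesz c0 Bc adj essW lambda lam.
(* The sets of approximate solutions form a filter base, refined below to an ultrafilter [U]. *)
pose D (e : R) := [set x | ip x x = 1 /\ `|lambda - ip (B x) x| < e%:C].
have FF : Filter (filter_from [set e : R | 0 < e] D).
  apply: filter_from_filter; first by exists 1 => /=.
  move=> e1 e2 e10 e20; exists (Num.min e1 e2) => /=; first by rewrite lt_min e10.
  move=> x [x1 xe]; split; split=> //; apply: lt_le_trans xe _;
    by rewrite lecR ge_min lexx ?orbT.
have PF : ProperFilter (filter_from [set e : R | 0 < e] D).
  apply: filter_from_proper => e /= e0.
  have [] := lam (ball (lambda : C) (e%:C : C)).
    by apply: nbhsx_ballx; rewrite ltcR.
  by move=> w [[x x1 <-] xe]; exists x.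
have [U [UU DU]] := ultraFilterLemma PF.
have PU : ProperFilter U by exact: ultra_proper.
have U1 : U [set x | ip x x = 1].
  by apply: DU; exists 1 => //= x [].
have Bl : (ip (B x) x : C) @[x --> U] --> (lambda : C).
  apply/cvgrPdist_lt => e /gt0C[r r0 ->].
  by apply: DU; exists r => //= x [].
have [x0 wl] := weak_limit riesz U1.
have wlc y : (ip x y : C) @[x --> U] --> (ip x0 y : C).
  apply: (cvgC_ext (cvgC_conj (wl y))) => [x|]; by rewrite -ipC.
have n1 : (ip x x : C) @[x --> U] --> (1 : C).
  apply: cvg_near_cst.
  by apply: (filterS _ U1) => x /= ->.
(* The limits along [U] of the squared norm and of the form at $x-x_0$; the cross terms are computed
   from weak convergence and the adjoint. *)
pose s := 1 - ip x0 x0; pose a := lambda - ip (B x0) x0.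
have Zs : (ip (x - x0) (x - x0) : C) @[x --> U] --> (s : C).
  apply: (cvgC_ext (cvgB (cvgB n1 (wlc x0))
    (cvgB (wl x0) (cvg_cst (ip x0 x0 : C))))) => [x /=|].
    by rewrite !fctE !(ipBl, ipBr); ring.
  by rewrite subrr subr0.
have Za : (ip (B (x - x0)) (x - x0) : C) @[x --> U] --> (a : C).
  apply: (cvgC_ext (cvgB (cvgB Bl (wlc (B' x0)))
    (cvgB (wl (B x0)) (cvg_cst (ip (B x0) x0 : C))))) => [x /=|].
    by rewrite !fctE [B (_ - _)]linearB/= !(ipBl, ipBr) -adj; ring.
  by rewrite subrr subr0 -adj.
have Z0 y : (ip (x - x0) y : C) @[x --> U] --> (0 : C).
  apply: (cvgC_ext (cvgB (wlc y) (cvg_cst (ip x0 y : C)))) => [x /=|].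
    by rewrite !fctE ipBl.
  by rewrite subrr.
have s_ge0 : 0 <= s by apply: (cvgC_ge0 Zs) => x; exact: dnorm_ge0.
have x0_ge0 : 0 <= ip x0 x0 by exact: dnorm_ge0.
(* If $s=0$, convergence to $x_0$ is strong; $|\langle Bz,z\rangle|\le c\langle z,z\rangle$ gives
   $a=0$, so $\lambda$ is the value at the unit vector $x_0$. *)
have [s0|s0] := eqVneq s 0.
  exists x0; first by apply/esym/eqP; rewrite -subr_eq0 -/s s0.
  have : a = 0.
    apply: (cvgC_unique Za); apply/cvgrPdist_lt => e e0.
    have cC : 0 < c%:C :> R[i] by rewrite ltcR.
    have /cvgrPdist_lt/(_ (e / c%:C)) := Zs; rewrite divr_gt0// => /(_ isT).
    apply: filterS => x; rewrite s0 !sub0r !normrN ger0_norm ?dnorm_ge0//.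
    rewrite ltr_pdivlMr// mulrC; apply: le_lt_trans.
    rewrite -ler_sqr ?nnegrE ?mulr_ge0 ?dnorm_ge0 ?(ltW cC)//.
    rewrite (le_trans (cauchy_schwarz _ _ _))// exprMn -rmorphXn/= expr2.
    by rewrite mulrA ler_wpM2r ?dnorm_ge0.
  by rewrite /a => /eqP; rewrite subr_eq0 => /eqP.
have mu : ess_num_range B (a / s) by exact: (ess_num_range_weakly_null adj s0 Z0 Za Zs).
(* If $x_0=0$, then $s=1$ and $\lambda=a/s$ is itself an essential value. Otherwise $\lambda$ is the
   convex combination, with weight $s$ on $a/s$, of $a/s$ and the normalised value at $x_0$. *)
have [x00|x00] := eqVneq x0 0.
  move: (essW _ mu); rewrite /a /s x00 !linear0r !subr0 divr1.
  by [].
pose t := complex.Re s.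
have ts : t%:C = s by apply/RRe_real/ger0_real.
have w0 : num_range ip B (ip (B x0) x0 / ip x0 x0).
  apply: (num_range_homogeneous x00); rewrite divfK// dnorm_eq0//.
have := toeplitz_hausdorff w0 (essW _ mu) (s := t).
have -> : (1 - t%:C) * (ip (B x0) x0 / ip x0 x0) + t%:C * (a / s) = lambda.
  rewrite ts /a [1 - s]subKr; field.
  by rewrite s0 dnorm_eq0.
apply; rewrite -!lecR ts s_ge0 /= /s.
by rewrite -subr_ge0 subKr.
Qed.

End EssentialNumericalRange.

(** * Perturbation of complex symmetric operators *)

Section Grid.
Context {R : realType}.

Lemma convex_comb_complex (s x y x' y' : R) :
  (1 - s%:C) * (x +i* y) + s%:C * (x' +i* y') =
  ((1 - s) * x + s * x') +i* ((1 - s) * y + s * y').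
Proof. by apply/eqP; rewrite eq_complex /=; apply/andP; split; apply/eqP; ring. Qed.

(** [L] consists of the grid points near [S]. A point of [S] differs by at most $d$ in each
    coordinate from the corners of its cell, so these corners belong to [L], and the point lies in
    their convex hull. *)
Lemma grid_cover (S : set R[i]) (M d : R) : 0 < d ->
  (forall z, S z -> `|z| <= M%:C) ->
  exists2 L : seq R[i],
    forall l, l \in L -> exists2 mu, S mu & `|l - mu| <= (2 * d)%:C &
    forall Q : set R[i],
      (forall w1 w2 (s : R), Q w1 -> Q w2 -> 0 <= s <= 1 ->
        Q ((1 - s%:C) * w1 + s%:C * w2)) ->
      (forall l, l \in L -> Q l) -> S `<=` Q.
Proof.
move=> d0 SM.
pose pt (j k : nat) : R[i] := (- M + j%:R * d) +i* (- M + k%:R * d).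
(* Cell indices run up to the truncation, corner indices up to one more, and [iota 0 N] excludes
   [N]. *)
pose N := (Num.truncn (2 * M / d)).+2.
pose near_S l := `[< exists2 mu, S mu & `|l - mu| <= (2 * d)%:C >].
exists [seq l <- [seq pt j k | j <- iota 0 N, k <- iota 0 N] | near_S l].
  by move=> l; rewrite mem_filter => /andP[/asboolP].
move=> Q convQ LQ [a b] Sz.
have coord (c : R) : `|c| <= M -> exists2 j : nat, (j.+1 < N)%N &
    exists2 s : R, 0 <= s <= 1 & c = - M + (j%:R + s) * d.
  rewrite ler_norml => /andP[cM1 cM2].
  have cM0 : 0 <= (c + M) / d by apply: divr_ge0; lra.
  exists (Num.truncn ((c + M) / d)).
    rewrite ltnS ltnS; apply: le_truncn; rewrite ler_pM2r ?invr_gt0//; lra.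
  have /andP[h1 h2] := truncn_itv cM0.
  exists ((c + M) / d - (Num.truncn ((c + M) / d))%:R).
    by apply/andP; split; [lra|rewrite -natr1 in h2; lra].
  by rewrite [_%:R + _]addrC subrK divfK ?gt_eqF// addrC addrK.
have zM := SM _ Sz.
have [j jN [s s01 aE]] : exists2 j : nat, (j.+1 < N)%N &
    exists2 s : R, 0 <= s <= 1 & a = - M + (j%:R + s) * d.
  by apply: coord; rewrite -lecR (le_trans (normc_ge_Re (a +i* b))).
have [k kN [t t01 bE]] : exists2 j : nat, (j.+1 < N)%N &
    exists2 s : R, 0 <= s <= 1 & b = - M + (j%:R + s) * d.
  apply: coord; rewrite -lecR (le_trans _ zM)// normc_def/= lecR.
  by rewrite -sqrtr_sqr ler_wsqrtr// lerDr sqr_ge0.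
have corner (u v : nat) : (u <= 1)%N -> (v <= 1)%N -> Q (pt (j + u)%N (k + v)%N).
  move=> u1 v1; apply: LQ; rewrite mem_filter; apply/andP; split.
    apply/asboolP; exists (a +i* b) => //.
    have -> : pt (j + u)%N (k + v)%N - (a +i* b) =
        ((u%:R - s) * d) +i* ((v%:R - t) * d).
      apply/eqP; rewrite eq_complex /= aE bE !natrD.
      by apply/andP; split; apply/eqP; ring.
    rewrite (le_trans (norm_le_Re_Im _ _))// lecR !normrM (gtr0_norm d0).
    rewrite -mulrDl ler_pM2r//.
    move/andP: s01 => [s0 s1]; move/andP: t01 => [t0 t1].
    have bnd (w : nat) (r : R) : (w <= 1)%N -> 0 <= r -> r <= 1 -> `|w%:R - r| <= 1.
      by case: w => [|[|//]] _ r0 r1; rewrite ler_norml/=; apply/andP; split; lra.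
    by have := bnd u s u1 s0 s1; have := bnd v t v1 t0 t1; lra.
  apply/allpairsP; exists ((j + u)%N, (k + v)%N); split=> //;
    rewrite mem_iota add0n /=.
    by rewrite (leq_ltn_trans _ jN)// -addn1 leq_add2l.
  by rewrite (leq_ltn_trans _ kN)// -addn1 leq_add2l.
(* Bilinear interpolation: along the two horizontal edges with parameter [s], then vertically with
   parameter [t]. *)
have := convQ _ _ t
  (convQ _ _ s (corner 0%N 0%N isT isT) (corner 1%N 0%N isT isT) s01)
  (convQ _ _ s (corner 0%N 1%N isT isT) (corner 1%N 1%N isT isT) s01) t01.
rewrite /pt !convex_comb_complex; congr Q; rewrite aE bE !natrD.
by apply/eqP; rewrite eq_complex /=; apply/andP; split; apply/eqP; ring.
Qed.

End Grid.

(** [pairwise] relates entries in list order only, so the vanishing hypothesis covers entries on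
    either side of [x]. *)
Lemma sum_pairwise (T : eqType) (M : nmodType) (r : rel T) (s : seq T) (x : T)
    (F : T -> M) : pairwise r s -> x \in s ->
  (forall y, r x y || r y x -> F y = 0) -> \sum_(y <- s) F y = F x.
Proof.
move=> + + F0; elim: s => //= a s IH /andP[/allP ra rs].
rewrite in_cons big_cons => /predU1P[xa|xs]; last first.
  by rewrite F0 ?add0r ?IH// ra ?orbT.
rewrite big_seq big1 ?addr0 ?xa// => y ys.
by rewrite F0// xa ra.
Qed.

Lemma exists_linear (K : nzRingType) (V W : lmodType K) (f : V -> W) :
  (forall a x y, f (a *: x + y) = a *: f x + f y) ->
  exists g : {linear V -> W}, (g : V -> W) = f.
Proof.
move=> lin.
pose mix := GRing.isLinear.Build K V W *:%R f lin.
pose g : {linear V -> W} := HB.pack f mix.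
by exists g.
Qed.

(** * Conjugations and the inner product *)

Section Conjugation.
Context {R : realType} {V : lmodType R[i]}.
Variables (ip : {dot V for (@Num.conj R[i])}) (J : V -> V).
Hypothesis conjJ : conjugation ip J.
Implicit Types (x y z u v : V) (s : seq (R[i] * V)).

Lemma conjugationK : involutive J. Proof. by case: conjJ. Qed.

Lemma conjugation0 : J 0 = 0.
Proof.
case: conjJ => lin _ _; have := lin 1 0 0.
by rewrite scaler0 addr0 conjC1 scale1r -{1}[J 0]addr0 => /addrI.
Qed.

Lemma conjugationD x y : J (x + y) = J x + J y.
Proof. by case: conjJ => lin _ _; have := lin 1 x y; rewrite conjC1 !scale1r. Qed.

Lemma conjugationZ a x : J (a *: x) = a^* *: J x.
Proof.
by case: conjJ => lin _ _; have := lin a x 0; rewrite conjugation0 !addr0.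
Qed.

(** Polarization: isometry at $x+y$ gives the sum, and at $ix+y$ the difference, of $\langle
    Jx,Jy\rangle$ and $\langle Jy,Jx\rangle$. *)
Lemma ip_conjugation x y : ip (J x) (J y) = ip y x.
Proof.
have nJ z : ip (J z) (J z) = ip z z.
  by case: conjJ => _ iso _; rewrite -!ipnormE iso.
have h1 : ip (J x) (J y) + ip (J y) (J x) = ip x y + ip y x.
  have := nJ (x + y).
  rewrite conjugationD !ipDl !ipDr !nJ => h.
  apply: (addrI (ip x x + ip y y)).
  transitivity (ip x x + ip (J x) (J y) + (ip (J y) (J x) + ip y y)); first by ring.
  by rewrite h; ring.
have h2 : ip (J x) (J y) - ip (J y) (J x) = ip y x - ip x y.
  have h : 'i * ('i^* * ip x x) + 'i^* * ip (J x) (J y) +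
      ('i * ip (J y) (J x) + ip y y) =
      'i * ('i^* * ip x x) + 'i * ip x y + ('i^* * ip y x + ip y y).
    have := nJ ('i *: x + y).
    rewrite conjugationD conjugationZ !ipDl !ipDr !ipZl !ipZr !nJ conjCK => <-.
    by ring.
  apply: (mulfI (neq0Ci R[i])); rewrite conjCi in h.
  transitivity ('i * (ip y x - ip x y) -
    (('i * (- 'i * ip x x) + - 'i * ip (J x) (J y) +
      ('i * ip (J y) (J x) + ip y y))
     - ('i * (- 'i * ip x x) + 'i * ip x y + (- 'i * ip y x + ip y y)))).
    by ring.
  by rewrite h subrr subr0.
have : 2 * ip (J x) (J y) = 2 * ip y x.
  transitivity ((ip (J x) (J y) + ip (J y) (J x)) +
    (ip (J x) (J y) - ip (J y) (J x))); first by ring.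
  by rewrite h1 h2; ring.
by apply: mulfI; rewrite pnatr_eq0.
Qed.

Lemma ip_conjugationC x y : ip (J x) y = ip (J y) x.
Proof. by rewrite -{1}[y]conjugationK ip_conjugation. Qed.

End Conjugation.

(** * Finite-rank diagonal operators *)

Section DiagonalOperators.
Context {R : realType} {V : lmodType R[i]}.
Variable ip : {dot V for (@Num.conj R[i])}.
Implicit Types (x y z u v : V) (s : seq (R[i] * V)).

(** The operator $\sum_p \mu_p\, e_p\otimes e_p$ for pairs $p=(\mu_p,e_p)$, with eigenvalues $\mu_p$
    when the $e_p$ are orthonormal. *)
Definition diag_op s x : V := \sum_(p <- s) (p.1 * ip x p.2) *: p.2.

Lemma diag_op_linear s a x y :
  diag_op s (a *: x + y) = a *: diag_op s x + diag_op s y.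
Proof.
rewrite /diag_op scaler_sumr -big_split; apply: eq_bigr => p _ /=.
by rewrite ipDl ipZl mulrDr scalerDl scalerA mulrCA.
Qed.

Lemma diag_op_cons p s x :
  diag_op (p :: s) x = (p.1 * ip x p.2) *: p.2 + diag_op s x.
Proof. by rewrite /diag_op big_cons. Qed.

Lemma diag_op_cat s1 s2 x : diag_op (s1 ++ s2) x = diag_op s1 x + diag_op s2 x.
Proof. by rewrite /diag_op big_cat. Qed.

Lemma diag_op_eq0 s x : (forall p, p \in s -> ip x p.2 = 0) -> diag_op s x = 0.
Proof.
move=> xs; rewrite /diag_op big_seq big1// => p ps.
by rewrite xs// mulr0 scale0r.
Qed.

Lemma diag_op_adjoint s :
  is_adjoint ip (diag_op s) (diag_op [seq (p.1^*, p.2) | p <- s]).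
Proof.
move=> x y; elim: s => [|p s IH]; first by rewrite /diag_op !big_nil linear0l linear0r.
rewrite /= !diag_op_cons ipDl ipDr ipZl ipZr IH /=.
by rewrite conjM conjCK -ipC mulrAC.
Qed.

Lemma ip_diag_op s x :
  ip (diag_op s x) x = \sum_(p <- s) p.1 * `|ip x p.2| ^+ 2.
Proof.
elim: s => [|p s IH]; first by rewrite /diag_op !big_nil linear0l.
by rewrite diag_op_cons big_cons ipDl ipZl IH -mulrA normCK -ipC.
Qed.

Lemma conjugation_diag_op J s x : conjugation ip J ->
  J (diag_op s (J x)) = diag_op [seq (p.1^*, J p.2) | p <- s] x.
Proof.
move=> conjJ; elim: s => [|p s IH].
  by rewrite /diag_op !big_nil (conjugation0 conjJ).
rewrite /= !diag_op_cons (conjugationD conjJ) (conjugationZ conjJ) IH conjM /=.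
by rewrite (ip_conjugationC conjJ) [ip x _]ipC.
Qed.

Lemma diag_op_le s (d : R) x :
  pairwise (fun p q => ip p.2 q.2 == 0) s ->
  (forall p, p \in s -> ip p.2 p.2 = 1 /\ `|p.1| <= d%:C) ->
  ip (diag_op s x) (diag_op s x) <= (d ^+ 2)%:C * ip x x.
Proof.
elim: s x => [|p s IH] x.
  by move=> _ _; rewrite /diag_op !big_nil linear0l mulr_ge0 ?dnorm_ge0// ler0c sqr_ge0.
move=> /=/andP[/allP op os] us; have [p1 pd] := us _ (mem_head _ _).
pose x' := x - ip x p.2 *: p.2.
have Dx : diag_op s x = diag_op s x'.
  rewrite -[x in LHS](subrK (ip x p.2 *: p.2)) -/x' addrC diag_op_linear.
  by rewrite diag_op_eq0 ?scaler0 ?add0r// => q /op/eqP.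
have oD : ip p.2 (diag_op s x') = 0.
  rewrite /diag_op; elim: (s) op => [|q r IHr] op; first by rewrite big_nil linear0r.
  rewrite big_cons ipDr ipZr (eqP (op q _)) ?mem_head// mulr0 add0r IHr// => t tr.
  by apply: op; rewrite in_cons tr orbT.
have xx : ip x x = `|ip x p.2| ^+ 2 + ip x' x'.
  rewrite normCK -ipC /x' !(ipBl, ipBr) !ipZl !ipZr p1 -[(ip x p.2)^*]ipC; ring.
rewrite diag_op_cons Dx ipDl !ipDr !ipZl !ipZr p1 oD.
rewrite [ip (diag_op s x') p.2]ipC oD conjC0 !mulr0 addr0 add0r mulr1.
rewrite -normCK normrM exprMn xx mulrDr lerD//; last first.
  by apply: IH => // q qs; apply: us; rewrite in_cons qs orbT.
rewrite ler_wpM2r ?exprn_ge0// rmorphXn/= ler_pXn2r// nnegrE//.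
exact: le_trans pd.
Qed.

End DiagonalOperators.

(** * The small complex symmetric perturbation *)

Section Perturbation.
Context {R : realType} {V : lmodType R[i]}.
Variables (ip : {dot V for (@Num.conj R[i])}) (J : V -> V).
Hypothesis conjJ : conjugation ip J.
Implicit Types (x y z u v : V) (s : seq (R[i] * V)).

(** Distinct vectors are kept apart from each other and from each other's conjugates, while $\langle
    e,Je\rangle$ for a single $e$ may be nonzero. *)
Definition J_orthogonal : rel (R[i] * V) :=
  fun p q => (ip p.2 q.2 == 0) && (ip p.2 (J q.2) == 0).

Lemma J_orthogonal_sym p q : J_orthogonal p q -> J_orthogonal q p.
Proof.
rewrite /J_orthogonal ip_eq0C => /andP[-> /eqP h] /=.
by rewrite ip_eq0C (ip_conjugationC conjJ) ip_eq0C h.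
Qed.

Definition J_sym s := s ++ [seq (p.1, J p.2) | p <- s].

(** Passing to the adjoint conjugates the coefficients; [J] conjugates them back and exchanges the
    two halves of [J_sym s]. *)
Lemma diag_op_J_sym s x :
  J (diag_op ip [seq (p.1^*, p.2) | p <- J_sym s] (J x)) = diag_op ip (J_sym s) x.
Proof.
rewrite (conjugation_diag_op _ _ conjJ) -map_comp /J_sym map_cat -map_comp.
rewrite !diag_op_cat addrC; congr (_ + _).
  rewrite (eq_map (g := id)) ?map_id// => p /=.
  by rewrite conjCK (conjugationK conjJ) -surjective_pairing.
by congr (diag_op ip _ x); apply: eq_map => p /=; rewrite conjCK.
Qed.

Lemma select_vectors (T : V -> V) (L : seq R[i]) (d : R) : 0 < d ->
  (forall l, l \in L -> exists2 mu, ess_num_range ip T mu & `|l - mu| <= (2 * d)%:C) ->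
  exists s, [/\ pairwise J_orthogonal s,
    forall p, p \in s -> ip p.2 p.2 = 1 /\ `|p.1| <= (3 * d)%:C &
    forall l, l \in L -> exists2 p, p \in s &
      l = ip (T p.2) p.2 + p.1 * (1 + `|ip p.2 (J p.2)| ^+ 2)].
Proof.
move=> d0; elim: L => [|l L IH] Lmu; first by exists [::].
have [|s [os us sL]] := IH.
  by move=> l' l'L; apply: Lmu; rewrite in_cons l'L orbT.
have [mu Tmu lmu] := Lmu _ (mem_head _ _).
(* The new vector avoids all earlier vectors and their conjugates, and $|l-\langle Tz,z\rangle|\le
   2d+d$. Dividing by $k\ge 1$, the value at $z$ of the form of $z\otimes z+Jz\otimes Jz$, keeps
   this bound. *)
have [z [z1 zs Tz]] := Tmu ([seq p.2 | p <- s] ++ [seq J p.2 | p <- s]) d d0.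
pose k : R[i] := 1 + `|ip z (J z)| ^+ 2.
have k1 : 1 <= k by rewrite lerDl exprn_ge0.
have k0 : 0 < k by apply: lt_le_trans k1.
exists (((l - ip (T z) z) / k, z) :: s); split.
- rewrite /= os andbT; apply/allP => p ps; rewrite /J_orthogonal /=.
  rewrite !zs ?eqxx// mem_cat; first by rewrite (map_f (fun p => J p.2)) ?orbT.
  by rewrite map_f.
- move=> p; rewrite in_cons => /predU1P[->/=|/us//]; split=> //.
  rewrite normrM normfV (gtr0_norm k0) ler_pdivrMr//.
  have : `|l - ip (T z) z| <= (3 * d)%:C.
    rewrite -(subrKA mu) (le_trans (ler_normD _ _))//.
    rewrite [in X in _ + X]distrC.
    have -> : (3 * d)%:C = (2 * d)%:C + d%:C by rewrite -rmorphD; congr _%:C; lra.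
    by rewrite lerD// ltW.
  move/le_trans; apply; rewrite ler_peMr// lecR; lra.
- move=> l'; rewrite in_cons => /predU1P[->|/sL[p ps ->]]; last first.
    by exists p => //; rewrite in_cons ps orbT.
  exists ((l - ip (T z) z) / k, z); first exact: mem_head.
  by rewrite /= -/k divfK ?gt_eqF// addrC subrK.
Qed.

Theorem closed_num_range_perturbation (T : {linear V -> V}) (T' : V -> V) (c e : R) :
  riesz_property ip -> 0 < c ->
  (forall x, ip (T x) (T x) <= (c ^+ 2)%:C * ip x x) ->
  is_adjoint ip T T' -> (forall x, T x = J (T' (J x))) -> 0 < e ->
  exists s, [/\ forall x, ip (diag_op ip s x) (diag_op ip s x) <= (e ^+ 2)%:C * ip x x,
    complex_symmetric ip (fun x => T x + diag_op ip s x) &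
    closure (num_range ip (fun x => T x + diag_op ip s x) : set (R[i] : numFieldType))
      `<=` num_range ip (fun x => T x + diag_op ip s x)].
Proof.
move=> riesz c0 Tc adjT TJ e0.
(* The coefficients are at most $3d=e/2$, and the perturbation is a sum of two diagonal operators,
   each of norm at most $e/2$. *)
pose d := e / 6; have d0 : 0 < d by rewrite divr_gt0.
have essM mu : ess_num_range ip T mu -> `|mu| <= (c + 1)%:C.
  move=> /(_ [::] 1 ltr01)[z [z1 _ zmu]].
  rewrite -(subrK (ip (T z) z) mu) (le_trans (ler_normD _ _))// addrC.
  rewrite rmorphD/= lerD//; last by rewrite distrC ltW.
  rewrite -ler_sqr ?nnegrE ?normr_ge0 ?ler0c ?(ltW c0)//; have := cauchy_schwarz ip (T z) z; move/le_trans; apply.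
  by rewrite z1 mulr1 (le_trans (Tc z))// z1 mulr1 rmorphXn.
have [L LS Lcover] := grid_cover d0 essM.
have [s [os us sL]] := select_vectors d0 LS.
exists (J_sym s).
have Dle x : ip (diag_op ip (J_sym s) x) (diag_op ip (J_sym s) x)
    <= (e ^+ 2)%:C * ip x x.
  rewrite /J_sym diag_op_cat (le_trans (ip_sqD_le _ _ _))//.
  have -> : (e ^+ 2)%:C * ip x x = 2 * (((3 * d) ^+ 2)%:C * (ip x x))
      + 2 * (((3 * d) ^+ 2)%:C * ip x x).
    have -> : e = 2 * (3 * d) by rewrite /d; field.
    by rewrite exprMn rmorphM /= rmorphXn rmorph_nat; ring.
  rewrite lerD// ler_pM2l ?ltr0n//; apply: diag_op_le.
  - by apply: sub_pairwise os => p q /andP[].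
  - exact: us.
  - rewrite pairwise_map; apply: sub_pairwise os => p q /andP[pq _] /=.
    by rewrite (ip_conjugation conjJ) ip_eq0C.
  - by move=> _ /mapP[p /us[p1 pd] ->]; rewrite /= (ip_conjugation conjJ).
have adjTK : is_adjoint ip (fun x => T x + diag_op ip (J_sym s) x)
    (fun x => T' x + diag_op ip [seq (p.1^*, p.2) | p <- J_sym s] x).
  by move=> x y; rewrite ipDl ipDr adjT diag_op_adjoint.
split=> //.
  exists J, (fun x => T' x + diag_op ip [seq (p.1^*, p.2) | p <- J_sym s] x).
  by split=> // x; rewrite (conjugationD conjJ) -TJ diag_op_J_sym.
have [B BE] : exists B : {linear V -> V},
    (B : V -> V) = (fun x => T x + diag_op ip (J_sym s) x).
  apply: exists_linear => a x y; rewrite linearP diag_op_linear scalerDr.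
  by rewrite addrACA.
have BL l : l \in L -> num_range ip B l.
  move=> /sL[p ps ->]; have [p1 _] := us _ ps.
  exists p.2 => //; rewrite BE ipDl; congr (_ + _).
  (* Evaluated at the vector of [p], only the term of [p] survives, by [J_orthogonal]. *)
  transitivity (\sum_(q <- s) q.1 * (`|ip p.2 q.2| ^+ 2 + `|ip p.2 (J q.2)| ^+ 2)).
    rewrite ip_diag_op /J_sym big_cat/= big_map/= -big_split/=.
    by apply: eq_bigr => q _; rewrite mulrDr.
  rewrite (sum_pairwise os ps) => [|q pq]; first by rewrite p1 normr1 expr1n.
  have /andP[/eqP -> /eqP ->] : J_orthogonal p q.
    by case/orP: pq => // /J_orthogonal_sym.
  by rewrite normr0 expr0n/= addr0 mulr0.
rewrite -BE in adjTK *.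
apply: (closed_num_range (c := 2 * (c + e)) riesz _ _ adjTK).
- by rewrite mulr_gt0// addr_gt0.
- by move=> x; rewrite BE; apply: ip_sqD_bound; rewrite ?(ltW c0) ?(ltW e0).
(* Essential values of [B] are essential values of [T]: vectors orthogonal to those of [J_sym s] are
   annihilated by the perturbation. *)
- apply: subset_trans (Lcover (num_range ip B) _ BL).
    move=> mu Bmu F r r0.
    have [z [z1 zF zmu]] := Bmu (F ++ [seq p.2 | p <- J_sym s]) r r0.
    exists z; split=> // [f fF|]; first by rewrite zF// mem_cat fF.
    move: zmu; rewrite BE diag_op_eq0 ?addr0// => p ps.
    by rewrite zF// mem_cat map_f ?orbT.
  by move=> w1 w2 t; exact: toeplitz_hausdorff.
Qed.

End Perturbation.

(** * Orthogonal projections and the Riesz representation *)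

Section Hilbert.
Context {R : realType} {H : completeNormedModType R[i]}.
Variable dot : {dot H for (@Num.conj R[i])}.
Hypothesis hdot : hilbert_dot dot.
Implicit Types (x y z w : H).
Notation C := (R[i] : numFieldType).

Lemma dot_le_norm x y : `|dot x y| <= `|x| * `|y|.
Proof.
rewrite -ler_sqr ?nnegrE ?mulr_ge0// exprMn -!hdot.
exact: cauchy_schwarz.
Qed.

Lemma dot_cvg_left (F : set_system H) {FF : Filter F} y z :
  F --> y -> (dot x z : C) @[x --> F] --> (dot y z : C).
Proof.
move=> Fy; apply/cvgrPdist_lt => e e0.
have z1 : 0 < `|z| + 1 by rewrite ltr_wpDl.
have /cvgrPdist_lt/(_ (e / (`|z| + 1))) := Fy; rewrite divr_gt0// => /(_ isT).
apply: filterS => x; rewrite ltr_pdivlMr// -ipBl => h.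
apply: le_lt_trans h; apply: le_trans (dot_le_norm _ _) _.
by rewrite ler_wpM2l// lerDl.
Qed.

(** Near-minimisers of the distance to [x] form a Cauchy filter by the parallelogram law; its limit
    is the projection. *)
Theorem projection_theorem (M : set H) x : closed M -> M 0 ->
  (forall a y z, M y -> M z -> M (a *: y + z)) ->
  exists y, M y /\ forall z, M z -> dot (x - y) z = 0.
Proof.
move=> clM M0 linM.
pose f m : R := complex.Re (dot (x - m) (x - m)).
have fE m : (f m)%:C = dot (x - m) (x - m) by exact: real_ip.
have f_ge0 m : 0 <= f m by rewrite -lecR fE dnorm_ge0.
pose d := inf [set f m | m in M].
have fI : has_inf [set f m | m in M].
  by split; [exists (f 0), 0|exists 0 => _ [m _ <-]].
have d_le m : M m -> d <= f m.
  by move=> Mm; apply: ge_inf; [case: fI|exists m].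
pose D (e : R) := [set m | M m /\ f m < d + e].
have Dn e : 0 < e -> D e !=set0.
  by move=> e0; have [_ [m Mm <-] me] := inf_adherent e0 fI; exists m.
have FF : Filter (filter_from [set e : R | 0 < e] D).
  apply: filter_from_filter; first by exists 1 => /=.
  move=> e1 e2 e10 e20; exists (Num.min e1 e2) => /=; first by rewrite lt_min e10.
  by move=> m [Mm me]; split; split=> //; apply: lt_le_trans me _;
    rewrite lerD2l ge_min lexx ?orbT.
have PF : ProperFilter (filter_from [set e : R | 0 < e] D).
  by apply: filter_from_proper => e /= e0; exact: Dn.
have : cauchy (filter_from [set e : R | 0 < e] D).
  apply: cauchy_exP => e /gt0C[r r0 ->].
  (* With [h] the midpoint of [m0] and [m], $2f(m_0)+2f(m)-4f(h)<4(d+r^2/8)-4d=r^2/2$. *)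
  have r8 : 0 < r ^+ 2 / 8 by rewrite divr_gt0// exprn_gt0.
  have [m0 [Mm0 m0d]] := Dn _ r8.
  exists m0; exists (r ^+ 2 / 8) => //= m [Mm md].
  rewrite -ball_normE /ball_/= -ltr_sqr ?nnegrE ?normr_ge0 ?ler0c ?(ltW r0)// -hdot.
  pose h := 2^-1 *: (1 *: m0 + m) + 0.
  have Mh : M h by apply: (linM) => //; exact: linM.
  have -> : dot (m0 - m) (m0 - m) = (2 * f m0 + 2 * f m - 4 * f h)%:C.
    have := parallelogram dot (x - m0) (x - m).
    have -> : x - m0 + (x - m) = 2 *: (x - h).
      rewrite scalerBr /h addr0 scale1r scalerA mulfV ?pnatr_eq0// scale1r.
      by rewrite scaler_nat mulr2n opprD addrACA.
    have -> : x - m0 - (x - m) = - (m0 - m).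
      by rewrite !opprB addrC subrKA.
    rewrite hnormN ipZl ipZr conjC_nat -!fE => hp.
    rewrite rmorphB rmorphD !rmorphM/= !rmorph_nat.
    apply: (addrI (2 * (2 * (f h)%:C))); rewrite hp; ring.
  rewrite -rmorphXn/= ltcR; have := d_le _ Mh; lra.
move=> /cauchy_cvg /cvg_ex[y Fy]; exists y; split.
  apply: clM => B By; have FB : filter_from [set e : R | 0 < e] D B by exact: Fy.
  have FM : filter_from [set e : R | 0 < e] D M by exists 1 => //= m [].
  by have [m [? ?]] := filter_ex (filterI FM FB); exists m.
move=> z Mz.
have h1 : (dot (x - m) z : C) @[m --> filter_from [set e : R | 0 < e] D] -->
    (dot (x - y) z : C).
  apply: (cvgC_ext (cvgB (cvg_cst (dot x z : C)) (dot_cvg_left (z := z) Fy))) => [m|].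
    by rewrite !fctE ipBl.
  by rewrite ipBl.
apply: (cvgC_unique h1); apply/cvgrPdist_lt => e /gt0C[r r0 ->].
have [->|z0] := eqVneq z 0.
  by apply: nearW => m; rewrite linear0r subrr normr0 ltcR.
have zz : 0 < dot z z by rewrite dnorm_gt0.
have [q q0 zq] := gt0C zz.
(* Moving [m] by the optimal multiple of [z] lowers [f] by $|\langle x-m,z\rangle|^2/q$, which
   cannot exceed $f(m)-d<r^2/q$. *)
exists (r ^+ 2 / q) => /=; first by rewrite divr_gt0// exprn_gt0.
move=> m [Mm md]; rewrite sub0r normrN -ltr_sqr ?nnegrE ?normr_ge0 ?ler0c ?(ltW r0)//.
pose t := dot (x - m) z / dot z z.
have := d_le _ (linM t z m Mz Mm).
rewrite -lecR fE.
have -> : x - (t *: z + m) = (x - m) - t *: z by rewrite opprD addrA addrAC.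
have -> : dot (x - m - t *: z) (x - m - t *: z) =
    (f m)%:C - `|dot (x - m) z| ^+ 2 / q%:C.
  rewrite -zq fE [_ - t *: z in LHS]lock.
  rewrite -lock [LHS]ipBl !(ipBr dot (x - m)) !(ipBr dot (t *: z)) !ipZl !ipZr.
  rewrite /t conjM conjV -[(dot z z)^*]ipC normCK -[(dot (x - m) z)^*]ipC.
  by field; rewrite gt_eqF.
rewrite lerBrDr -lerBrDl -rmorphB/= ler_pdivrMr ?ltcR// -rmorphM/= => h.
apply: le_lt_trans h _; rewrite -rmorphXn/= ltcR -ltr_pdivlMr//; lra.
Qed.

Theorem riesz_representation : riesz_property dot.
Proof.
move=> phi phil c phic.
have phi0 : phi 0 = 0.
  have := phil 1 0 0; rewrite scaler0 addr0 mul1r -{1}[phi 0]addr0.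
  by move/addrI.
have phiZ a x : phi (a *: x) = a * phi x.
  by have := phil a x 0; rewrite !addr0 phi0 addr0.
have phiB x y : phi (x - y) = phi x - phi y.
  by rewrite addrC -scaleN1r phil mulN1r addrC.
have [[u pu]|n] := pselect (exists u, phi u != 0); last first.
  exists 0 => x; rewrite linear0r; apply/eqP; apply: contrapT => /negP px.
  by apply: n; exists x.
(* If $\varphi(x)\ne 0$, then $|\varphi(x)|^2=|\varphi(x-m)|^2\le c\|x-m\|^2$ for [m] in the kernel,
   which therefore avoids a ball around [x]. Replacing [c] by $|c|+1\ge 1$ makes the radius
   meaningful. *)
have clM : closed [set x | phi x = 0].
  move=> x xM; apply/eqP; apply: contrapT => /negP px.
  have [q q0 qE] : exists2 q : R, 0 < q & `|phi x| = q%:C.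
    by apply: gt0C; rewrite normr_gt0.
  pose c' := `|c| + 1; have c'0 : 0 < c' by rewrite ltr_wpDl.
  have [] := xM (ball x (q / c')%:C).
    by apply: nbhsx_ballx; rewrite ltcR divr_gt0.
  move=> m [/= pm]; rewrite -ball_normE /ball_/= => xm.
  have := phic (x - m); rewrite phiB pm subr0 qE hdot => h.
  have : (q ^+ 2)%:C < (q ^+ 2)%:C :> R[i].
    rewrite {1}rmorphXn/=; apply: le_lt_trans h _.
    apply: (@le_lt_trans _ _ (c'%:C * `|x - m| ^+ 2)).
      by rewrite ler_wpM2r ?exprn_ge0// lecR /c'; have := ler_norm c; lra.
    apply: (@lt_le_trans _ _ (c'%:C * ((q / c')%:C) ^+ 2)).
      by rewrite ltr_pM2l ?ltcR// ltr_pXn2r ?nnegrE// ler0c divr_ge0 ?ltW.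
    rewrite -rmorphXn -rmorphM/= lecR.
    have -> : c' * (q / c') ^+ 2 = q ^+ 2 / c' by field; rewrite gt_eqF.
    by rewrite ler_pdivrMr// ler_peMr ?sqr_ge0// lerDr.
  by rewrite ltxx.
have [||y [py yM]] := projection_theorem u clM.
- exact: phi0.
- by move=> a y z /= py pz; rewrite phil py pz mulr0 addr0.
pose v := u - y.
have pv : phi v != 0 by rewrite phiB py subr0.
have v0 : v != 0 by apply: contraNneq pv => ->; rewrite phi0.
have vv : dot v v != 0 by rewrite dnorm_eq0.
exists ((phi v / dot v v)^* *: v) => x; rewrite ipZr conjCK.
have : dot v (x - (phi x / phi v) *: v) = 0.
  by apply: yM; rewrite /= phiB phiZ divfK// subrr.
rewrite ipBr ipZr conjM conjV => /eqP; rewrite subr_eq0 => /eqP vx.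
rewrite ipC vx !conjM conjV !conjCK -ipC; field.
by rewrite pv vv.
Qed.

(** Polarization: the form is real at $ay+x$; the cases $a=1$ and $a=i$ determine the mixed
    terms. *)
Lemma positive_selfadjoint (B : {linear H -> H}) :
  positive_op dot B -> forall x y, dot (B x) y = dot x (B y).
Proof.
move=> Bpos x y.
have Br z : (dot (B z) z)^* = dot (B z) z by apply/CrealP/ger0_real.
have BD a : a^* * dot (B x) y + a * dot (B y) x = dot (B (a *: y + x)) (a *: y + x)
    - a * a^* * dot (B y) y - dot (B x) x.
  by rewrite [B (_ + _)]linearP !(ipDl, ipDr) !ipZl !ipZr; ring.
have sym a : (a^* * dot (B x) y + a * dot (B y) x)^* =
    a^* * dot (B x) y + a * dot (B y) x.
  by rewrite BD !conjB !conjM !Br conjCK; ring.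
have h1 : (dot (B x) y)^* + (dot (B y) x)^* = dot (B x) y + dot (B y) x.
  by have := sym 1; rewrite conjC1 !mul1r conjD.
have h2 : (dot (B x) y)^* - (dot (B y) x)^* = dot (B y) x - dot (B x) y.
  apply: (mulfI (neq0Ci R[i])); have := sym 'i.
  rewrite conjD !conjM conjCK conjCi => h.
  transitivity ('i * (dot (B x) y)^* + - 'i * (dot (B y) x)^*); first by ring.
  by rewrite h; ring.
have h3 : 2 * (dot (B x) y)^* = 2 * dot (B y) x.
  transitivity (((dot (B x) y)^* + (dot (B y) x)^*) +
    ((dot (B x) y)^* - (dot (B y) x)^*)); first by ring.
  by rewrite h1 h2; ring.
have h4 : (dot (B x) y)^* = dot (B y) x by apply: mulfI h3; rewrite pnatr_eq0.
by rewrite [RHS]ipC -h4 conjCK.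
Qed.

End Hilbert.

(** * Transport between [H] and the range of the square root *)

Section Subsequences.
Context {R : realType}.
Notation C := (R[i] : numFieldType).

Lemma cvgn_extraction (T : topologicalType) (u : nat -> T) (l : T) (phi : nat -> nat) :
  {homo phi : m n / (m < n)%N} -> u n @[n --> \oo] --> l ->
  u (phi n) @[n --> \oo] --> l.
Proof.
move=> phim ul; have phin n : (n <= phi n)%N.
  by elim: n => // n IH; apply: leq_ltn_trans IH _; exact: phim.
apply: (@cvg_comp _ _ _ phi u \oo \oo) => //.
apply/cvgnyPge => A; exists A => // n /= An.
exact: (leq_trans An).
Qed.

Lemma bolzano_weierstrass_homo (u : nat -> R) (M : R) :
  (forall n, `|u n| <= M) -> exists2 phi : nat -> nat,
    {homo phi : m n / (m < n)%N} & exists l : R, u (phi n) @[n --> \oo] --> l.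
Proof.
move=> uM; have [|phi phim /cvg_ex[l ul]] := @bolzano_weierstrass R u.
  exists M; split; first exact: num_real.
  by move=> N MN n _ /=; rewrite (le_trans (uM n))// ltW.
exists phi; last by exists l.
by move=> m n mn; rewrite ltnNge -[(_ <= _)%N]/(phi n <= phi m)%O phim -ltnNge.
Qed.

Lemma bolzano_weierstrass_complex (u : nat -> R[i]) (M : R) :
  (forall n, `|u n| <= M%:C) -> exists2 phi : nat -> nat,
    {homo phi : m n / (m < n)%N} &
    exists l : R[i], (u (phi n) : C) @[n --> \oo] --> (l : C).
Proof.
move=> uM.
have [|phi phim [a ha]] := @bolzano_weierstrass_homo (fun n => complex.Re (u n)) M.
  by move=> n; rewrite -lecR (le_trans (normc_ge_Re _)).
have [|psi psim [b hb]] := @bolzano_weierstrass_homo (fun n => complex.Im (u (phi n))) M.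
  move=> n; rewrite -lecR (le_trans _ (uM (phi n)))// normc_def lecR.
  by rewrite -sqrtr_sqr ler_wsqrtr// lerDr sqr_ge0.
exists (phi \o psi) => [m n mn|]; first by apply: phim; exact: psim.
exists (a +i* b); apply: cvgC_Re_Im => //.
exact: (cvgn_extraction (u := fun n => complex.Re (u (phi n)))).
Qed.

Lemma bolzano_weierstrass_seq (I : eqType) (s : seq I) (u : I -> nat -> R[i])
    (M : I -> R) : (forall p n, `|u p n| <= (M p)%:C) ->
  exists2 phi : nat -> nat, {homo phi : m n / (m < n)%N} &
    forall p, p \in s -> exists l : R[i], (u p (phi n) : C) @[n --> \oo] --> (l : C).
Proof.
move=> uM; elim: s => [|p s [phi phim IH]]; first by exists id.
have [|psi psim [l ul]] := @bolzano_weierstrass_complex (fun n => u p (phi n)) (M p).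
  by move=> n.
exists (phi \o psi) => [m n mn|q]; first by apply: phim; exact: psim.
rewrite in_cons => /predU1P[->|/IH[l' ul']]; first by exists l.
by exists l'; exact: (cvgn_extraction (u := fun n => u q (phi n) : C)).
Qed.

End Subsequences.

(** Conjugate-linearity in the second variable follows from hermitian symmetry. *)
Lemma exists_dot (R : realType) (V : lmodType R[i]) (f : V -> V -> R[i]) :
  (forall a x y z, f (a *: x + y) z = a * f x z + f y z) ->
  (forall x y, f x y = (f y x)^*) -> (forall x, x != 0 -> 0 < f x x) ->
  exists ip : {dot V for (@Num.conj R[i])}, (ip : V -> V -> R[i]) = f.
Proof.
move=> fl fh fp.
have bil : bilinear_for *%R (@Num.conj R[i] \; *%R) f.
  split=> u' a x y /=; first exact: fl.
  by rewrite fh fl conjD conjM -!fh.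
have herm x y : f x y = (-1) ^+ false * (f y x)^* by rewrite expr0 mul1r.
pose m1 := bilinear_isBilinear.Build R[i] V V R[i] *%R (@Num.conj R[i] \; *%R) f bil.
pose m2 := isHermitianSesquilinear.Build R[i] V false (@Num.conj R[i]) f herm.
pose m3 := isDotProduct.Build R[i] V f fp.
pose ip : {dot V for @Num.conj R[i]} := HB.pack f m1 m2 m3.
by exists ip.
Qed.

(** * The Hilbert space $\mathbf{R}(A^{1/2})$ when $R(A)$ is closed *)

Section SquareRoot.
Context {R : realType} {H : completeNormedModType R[i]}.
Variable dot : {dot H for (@Num.conj R[i])}.
Hypothesis hdot : hilbert_dot dot.
Variables A S : {linear H -> H}.
Hypotheses (A_closed : closed (range A)) (S_sqrt : is_sqrt_op dot A S).
Implicit Types (x y z w : H) (u v : range_space S).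

Notation P := (orth_proj dot (closure (range A))).

Lemma sqrt_selfadjoint x y : dot (S x) y = dot x (S y).
Proof. by case: S_sqrt => _ S_pos _; exact: positive_selfadjoint. Qed.

Lemma sqrtE x : S (S x) = A x.
Proof. by case: S_sqrt. Qed.

Lemma sqrt_op_selfadjoint x y : dot (A x) y = dot x (A y).
Proof. by rewrite -!sqrtE !sqrt_selfadjoint. Qed.

Lemma ipA_sqrt x y : ipA dot A x y = dot (S x) (S y).
Proof. by rewrite /ipA -sqrtE sqrt_selfadjoint. Qed.

Lemma sqrt_ker x : A x = 0 -> S x = 0.
Proof.
move=> Ax; apply/eqP; rewrite -(dnorm_eq0 dot) -ipA_sqrt /ipA Ax.
by rewrite linear0l.
Qed.

Lemma orth_projP x : range A (P x) /\ forall z, dot (x - P x) (A z) = 0.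
Proof.
rewrite -(closure_id _).1//.
have ex : exists y,
    [set y | range A y /\ forall z, range A z -> dot (x - y) z = 0] y.
  apply: projection_theorem => //; first by exists 0; rewrite ?linear0.
  by move=> a _ _ [y _ <-] [z _ <-]; exists (a *: y + z); rewrite ?linearP.
have [Px Pz] := xgetPex 0 ex.
by split=> // z; apply: Pz; exists z.
Qed.

(** $x-Px$ is orthogonal to $R(A)$, hence in $\ker A=\ker S$. *)
Lemma sqrt_proj x : S (P x) = S x.
Proof.
have [_ Pz] := orth_projP x.
apply/esym/eqP; rewrite -subr_eq0 -linearB; apply/eqP/sqrt_ker/eqP.
by rewrite -(dnorm_eq0 dot) sqrt_op_selfadjoint Pz.
Qed.

Lemma range_sqrt_inj x : range A x -> S x = 0 -> x = 0.
Proof.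
move=> [w _ <-] SAw; apply/eqP; rewrite -(dnorm_eq0 dot).
by rewrite -{2}sqrtE -sqrt_selfadjoint SAw linear0l.
Qed.

(** Both sides lie in $R(A)$, where [S] is injective, and have the same image under [S]. *)
Lemma proj_linear a x y : P (a *: x + y) = a *: P x + P y.
Proof.
apply/eqP; rewrite -subr_eq0; apply/eqP; apply: range_sqrt_inj; last first.
  by rewrite linearB linearP !sqrt_proj [S (_ + _)]linearP subrr.
have [[u _ <-] _] := orth_projP (a *: x + y).
have [[v _ <-] _] := orth_projP x; have [[w _ <-] _] := orth_projP y.
by exists (u - (a *: v + w)); rewrite // linearB linearP.
Qed.

Lemma proj_eq x y : S x = S y -> P x = P y.
Proof.
move=> xy; apply/eqP; rewrite -subr_eq0; apply/eqP; apply: range_sqrt_inj.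
  have [[u _ <-] _] := orth_projP x; have [[v _ <-] _] := orth_projP y.
  by exists (u - v); rewrite // linearB.
by rewrite linearB !sqrt_proj xy subrr.
Qed.

Lemma proj_sqrt x : P (S x) = S x.
Proof.
have [[w _ Pw] Pz] := orth_projP (S x).
have rP : dot (S x - P (S x)) (P (S x)) = 0 by rewrite -{2}Pw Pz.
apply/esym/eqP; rewrite -subr_eq0 -(dnorm_eq0 dot) ipBr rP subr0.
by rewrite -sqrt_selfadjoint linearB sqrt_proj subrr linear0l.
Qed.

(** Closedness of $R(A)$ gives $Px=Aw$ for some $w$, so $Sx=SPx=SAw=A(Sw)$: the ranges of [S] and
    [A] coincide. *)
Lemma range_sqrt x : exists a, A a = S x.
Proof.
have [[w _ Pw] _] := orth_projP x.
by exists (S w); rewrite -[RHS]sqrt_proj -Pw -!sqrtE.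
Qed.

Definition sqrt_elt x : range_space S :=
  RangeSpace (asboolT (ex_intro2 _ _ x I erefl)).

Lemma sqrt_eltE x : range_val (sqrt_elt x) = S x. Proof. by []. Qed.

Lemma sqrt_elt_surj u : exists x, u = sqrt_elt x.
Proof.
by have /asboolP[x _ xu] := range_valP u; exists x; apply: val_inj.
Qed.

Lemma range_dotE x y : range_dot dot A (sqrt_elt x) (sqrt_elt y) = dot (P x) (P y).
Proof.
have pre z : P (range_preim (sqrt_elt z)) = P z.
  apply: proj_eq.
  have ex : exists y, [set y | S y = range_val (sqrt_elt z)] y by exists z.
  exact: (xgetPex 0 ex).
by rewrite /range_dot !pre.
Qed.

Lemma sqrt_elt_linear a x y : sqrt_elt (a *: x + y) = a *: sqrt_elt x + sqrt_elt y.
Proof. by apply: val_inj; rewrite /= linearP. Qed.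

Lemma range_dot_exists : exists ip : {dot (range_space S) for (@Num.conj R[i])},
  (ip : range_space S -> range_space S -> R[i]) = range_dot dot A (S := S).
Proof.
apply: exists_dot.
- move=> a u v w; have [x ->] := sqrt_elt_surj u; have [y ->] := sqrt_elt_surj v.
  have [z ->] := sqrt_elt_surj w.
  by rewrite -sqrt_elt_linear !range_dotE proj_linear ipDl ipZl.
- move=> u v; have [x ->] := sqrt_elt_surj u; have [y ->] := sqrt_elt_surj v.
  by rewrite !range_dotE ipC.
- move=> u; have [x ->] := sqrt_elt_surj u; rewrite range_dotE dnorm_gt0.
  apply: contraNneq => Px; apply/eqP/val_inj.
  by rewrite /= -sqrt_proj Px linear0.
Qed.

Lemma range_dot_riesz (ip : {dot (range_space S) for (@Num.conj R[i])}) :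
  (ip : range_space S -> range_space S -> R[i]) = range_dot dot A (S := S) ->
  riesz_property ip.
Proof.
move=> ipE phi phil c phic.
have Pz x y : dot (x - P x) (P y) = 0.
  have [_ Px] := orth_projP x; have [[w _ <-] _] := orth_projP y; exact: Px.
have Ple x : dot (P x) (P x) <= dot x x.
  by have := hnormDd (Pz x x); rewrite subrK => ->; rewrite lerDr dnorm_ge0.
(* The functional is pulled back to [H], where it is bounded because $\|Px\|\le\|x\|$; the absolute
   value of [c] keeps the inequalities monotone. *)
have [w hw] : exists w, forall x, phi (sqrt_elt x) = dot x w.
  apply: (riesz_representation hdot _ (c := `|c|)) => [a x y|x].
    by rewrite sqrt_elt_linear phil.
  apply: (le_trans (phic _)); rewrite ipE range_dotE.
  apply: (@le_trans _ _ (`|c|%:C * dot (P x) (P x))).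
    by rewrite ler_wpM2r ?dnorm_ge0// lecR ler_norm.
  by rewrite ler_wpM2l// ler0c.
exists (sqrt_elt w) => u; have [x ->] := sqrt_elt_surj u.
have -> : sqrt_elt x = sqrt_elt (P x) by apply: val_inj; rewrite /= sqrt_proj.
rewrite hw ipE range_dotE.
have -> : P (P x) = P x by apply: proj_eq; rewrite sqrt_proj.
apply/eqP; rewrite -subr_eq0 -ipBr ipC Pz; exact/eqP/conjC0.
Qed.

(* The vector A x, as an element of R(A^(1/2)). *)
Definition image_elt x : range_space S := sqrt_elt (S x).

Lemma image_eltE x : range_val (image_elt x) = A x.
Proof. by rewrite sqrt_eltE sqrtE. Qed.

Lemma image_elt_surj u : exists x, u = image_elt x.
Proof.
have [x ->] := sqrt_elt_surj u; have [a aE] := range_sqrt x.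
by exists a; apply: val_inj; rewrite /= sqrtE aE.
Qed.

Lemma image_elt_dot x y : range_dot dot A (image_elt x) (image_elt y) = ipA dot A x y.
Proof. by rewrite range_dotE !proj_sqrt ipA_sqrt. Qed.

End SquareRoot.

(** * Lifting finite-rank operators from $\mathbf{R}(A^{1/2})$ to $\mathcal{H}$ *)

Section Transport.
Context {R : realType} {H : completeNormedModType R[i]}.
Variable dot : {dot H for (@Num.conj R[i])}.
Hypothesis hdot : hilbert_dot dot.
Variables A S : {linear H -> H}.
Hypotheses (A_closed : closed (range A)) (S_sqrt : is_sqrt_op dot A S).
Variable ip : {dot (range_space S) for (@Num.conj R[i])}.
Hypothesis ipE : (ip : range_space S -> range_space S -> R[i]) =
  range_dot dot A (S := S).
Implicit Types (x y z : H) (u v : range_space S) (s : seq (R[i] * range_space S)).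
Notation C := (R[i] : numFieldType).

Lemma ipnorm_norm x : (ipnorm dot x)%:C = `|x|.
Proof.
apply/eqP; rewrite -(@eqrXn2 _ 2) ?ler0c ?sqrtr_ge0//.
by rewrite -hdot -ipnormE rmorphXn.
Qed.

Lemma image_elt_ip x y : ip (image_elt S x) (image_elt S y) = ipA dot A x y.
Proof. by rewrite ipE (image_elt_dot hdot A_closed S_sqrt). Qed.

Lemma normA_image_elt x : normA dot A x = ipnorm ip (image_elt S x).
Proof. by rewrite /normA /ipnorm image_elt_ip. Qed.

Lemma image_elt_linear a x y :
  image_elt S (a *: x + y) = a *: image_elt S x + image_elt S y.
Proof. by rewrite /image_elt linearP sqrt_elt_linear. Qed.

Lemma normA_sqrt x : normA dot A x = ipnorm dot (S x).
Proof. by rewrite /normA /ipnorm (ipA_sqrt S_sqrt). Qed.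

Section Lift.
Variables (lift : range_space S -> H) (s : seq (R[i] * range_space S)).
Hypothesis liftE : forall u, u = image_elt S (lift u).

(** The section [lift] need not be linear: it is applied only to the fixed vectors [p.2], so the
    lifted operator is linear all the same. *)
Definition lift_op x : H :=
  \sum_(p <- s) (p.1 * ip (image_elt S x) p.2) *: lift p.2.

Lemma lift_op_linear a x y : lift_op (a *: x + y) = a *: lift_op x + lift_op y.
Proof.
rewrite /lift_op scaler_sumr -big_split; apply: eq_bigr => p _ /=.
by rewrite image_elt_linear ipDl ipZl mulrDr scalerDl scalerA mulrCA.
Qed.

Lemma image_elt_lift_op x :
  image_elt S (lift_op x) = diag_op ip s (image_elt S x).
Proof.
rewrite /lift_op /diag_op; elim: s => [|p t IH].
  by rewrite !big_nil; apply: val_inj; rewrite /= !linear0.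
by rewrite !big_cons image_elt_linear IH -liftE.
Qed.

Lemma lift_op_bounded : bounded_op dot lift_op.
Proof.
have [cS cS0 hS] : bounded_op dot S by case: S_sqrt.
have [c c0 hc] : exists2 c : R[i], 0 <= c & forall x, `|lift_op x| <= c * `|x|.
  rewrite /lift_op; elim: s => [|p t [c c0 hc]].
    by exists 0 => // x; rewrite big_nil normr0 mul0r.
  exists (`|p.1| * (cS * ipnorm ip p.2)%:C * `|lift p.2| + c).
    by rewrite addr_ge0// !mulr_ge0// ler0c mulr_ge0 ?sqrtr_ge0// ltW.
  move=> x; rewrite big_cons (le_trans (ler_normD _ _))// mulrDl lerD//.
  rewrite normrZ normrM -!mulrA ler_wpM2l//.
  rewrite [`|lift p.2| * _]mulrC mulrA ler_wpM2r//.
  rewrite (le_trans (ip_le_ipnorm ip _ _))// -ipnorm_norm -rmorphM/= lecR.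
  rewrite mulrAC ler_wpM2r ?sqrtr_ge0// -normA_image_elt normA_sqrt.
  exact: hS.
(* Adding 1 makes the constant strictly positive. *)
exists (complex.Re c + 1).
  by rewrite ltr_wpDl//; move: c0; rewrite lecE => /andP[].
move=> x; rewrite -lecR rmorphM/= !ipnorm_norm (le_trans (hc x))// ler_wpM2r//.
have <- : (complex.Re c)%:C = c by apply/RRe_real/ger0_real.
by rewrite lecR lerDl.
Qed.

(** The finitely many coefficients are bounded sequences, so along a common subsequence the images
    converge in [H], hence also in the seminorm, since $\|y\|_A=\|Sy\|\le c_S\|y\|$. *)
Lemma lift_op_compact (x_ : nat -> H) (M : R) :
  (forall n, normA dot A (x_ n) <= M) ->
  exists (phi : nat -> nat) (y : H), {homo phi : m n / (m < n)%N} /\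
    normA dot A (lift_op (x_ (phi n)) - y) @[n --> \oo] --> (0 : R).
Proof.
move=> xM.
pose u (p : R[i] * range_space S) n := p.1 * ip (image_elt S (x_ n)) p.2.
have [|phi phim hu] := @bolzano_weierstrass_seq R _ s u
    (fun p => complex.Re `|p.1| * (M * ipnorm ip p.2)).
  move=> p n; have mE : (complex.Re `|p.1|)%:C = `|p.1| by exact/RRe_real/normr_real.
  have -> (a b : R) : (a * b)%:C = a%:C * b%:C :> R[i] by exact: rmorphM.
  rewrite normrM mE ler_wpM2l//.
  rewrite (le_trans (ip_le_ipnorm ip _ _))// lecR ler_wpM2r ?sqrtr_ge0//.
  by rewrite -normA_image_elt.
have [y hy] : exists y : H, lift_op (x_ (phi n)) @[n --> \oo] --> y.
  rewrite /lift_op; elim: s hu => [|p t IH] hu.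
    exists 0; under eq_fun do rewrite big_nil; exact: cvg_cst.
  have [|y hy] := IH; first by move=> q qt; apply: hu; rewrite in_cons qt orbT.
  have [l hl] := hu _ (mem_head _ _).
  exists (l *: lift p.2 + y); under eq_fun do rewrite big_cons.
  by apply: cvgD hy; apply: cvgZr_tmp.
exists phi, y; split=> //.
have [cS cS0 hS] : bounded_op dot S by case: S_sqrt.
apply/cvgrPdist_lt => e e0.
have e1 : 0 < (e / cS)%:C :> R[i] by rewrite ltcR divr_gt0.
have /cvgrPdist_lt/(_ _ e1) := hy; apply: filterS => n.
rewrite distrC -ipnorm_norm ltcR ltr_pdivlMr// mulrC => h.
rewrite sub0r normrN ger0_norm ?sqrtr_ge0// normA_sqrt.
exact: le_lt_trans (hS _) h.
Qed.

End Lift.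

End Transport.

(** * Transfer of the perturbation back to $\mathcal{H}$ *)

Theorem theorem4p8 (R : realType) (H : completeNormedModType R[i])
    (dot : {dot H for (@Num.conj R[i])}) (hdot : hilbert_dot dot)
    (Hsep : separable H) (Hinf : infinite_dimensional H)
    (A : {linear H -> H}) (A_bounded : bounded_op dot A)
    (A_pos : positive_op dot A) (A_neq0 : exists x, A x != 0)
    (A_closed : closed (range A))
    (T : {linear H -> H}) (T_BA : in_BA dot A T)
    (T_cs : induces_complex_symmetric dot A T)
    (eps : R) (eps_gt0 : 0 < eps) :
  exists K : {linear H -> H},
    [/\ in_KA dot A K,
        opnormA dot A K < eps,
        induces_complex_symmetric dot A (T \+ K) &
        closure (num_rangeA dot A (T \+ K)) = num_rangeA dot A (T \+ K)].
Proof.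
have [S S_sqrt [Tt [[c c0 Ttc] TtA]]] := T_cs.
have [ip ipE] := range_dot_exists hdot A_closed S_sqrt.
rewrite -ipE in Ttc * => -[J [Tt' [conjJ adjT TtJ]]].
have riesz := range_dot_riesz hdot A_closed S_sqrt ipE.
(* A supremum is only bounded weakly; halving [eps] secures the strict inequality. *)
have e2 : 0 < eps / 2 by rewrite divr_gt0.
have Ttc2 u : ip (Tt u) (Tt u) <= (c ^+ 2)%:C * ip u u.
  by apply: ip_le_of_bounded (Ttc u); exact: ltW.
have [s [Ks csK clK]] :=
  closed_num_range_perturbation conjJ riesz c0 Ttc2 adjT TtJ e2.
have [lift liftE] := choice (image_elt_surj hdot A_closed S_sqrt).
have [K KE] := exists_linear (lift_op_linear ip lift s).
have DE x : image_elt S (K x) = diag_op ip s (image_elt S x).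
  by rewrite KE (image_elt_lift_op ip s liftE).
have KA x : normA dot A (K x) <= eps / 2 * normA dot A x.
  rewrite !(normA_image_elt hdot A_closed S_sqrt ipE) DE.
  by apply: (ipnorm_le (ltW e2)); exact: Ks.
have TKE x : image_elt S (T x) = Tt (image_elt S x).
  apply: val_inj; rewrite [RHS](TtA x) ?(image_eltE S_sqrt)//.
  exact: (image_eltE S_sqrt).
have [TK TKl] : exists TK : {linear range_space S -> range_space S},
    (TK : range_space S -> range_space S) = (fun u => Tt u + diag_op ip s u).
  apply: exists_linear => a u v; rewrite linearP diag_op_linear scalerDr.
  by rewrite addrACA.
have TKx x : image_elt S ((T \+ K) x) = TK (image_elt S x).
  rewrite TKl -DE -TKE /=.
  by have := image_elt_linear S 1 (T x) (K x); rewrite !scale1r.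
exists K; split.
- split.
    split; last by exists (eps / 2).
    by rewrite KE; exact: (lift_op_bounded hdot A_closed S_sqrt ipE).
  move=> x_ [M xM]; rewrite KE.
  exact: (lift_op_compact hdot A_closed S_sqrt ipE lift s xM).
- rewrite /opnormA; set E := [set _ | _ in _].
  apply: (@le_lt_trans _ _ (eps / 2)); last by lra.
  have [->|/set0P E0] := eqVneq E set0; first by rewrite sup0 ltW.
  apply: ge_sup => // _ [x _ <-].
  (* A quotient with zero denominator is 0 by convention. *)
  have [->|x0] := eqVneq (normA dot A x) 0; first by rewrite invr0 mulr0 ltW.
  by rewrite ler_pdivrMr ?KA// lt_def x0 sqrtr_ge0.
- exists S => //; exists TK; last by rewrite -ipE TKl.
  split; last first.
    move=> x u ux; have -> : u = image_elt S x.
      by apply: val_inj; rewrite /= ux (sqrtE S_sqrt).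
    by rewrite -TKx /= (sqrtE S_sqrt).
  rewrite -ipE; exists (2 * (c + eps / 2)).
    by rewrite mulr_gt0// addr_gt0.
  move=> u; rewrite TKl; apply: (ipnorm_le (f := fun u => Tt u + diag_op ip s u)).
    by rewrite mulr_ge0// addr_ge0// ltW.
  by apply: ip_sqD_bound; [exact: ltW|exact: ltW|exact: Ttc2|exact: Ks].
(* [image_elt] carries $A$-unit vectors onto unit vectors, with preimages given by [lift], and
   intertwines $T+K$ with [TK]. *)
- have -> : num_rangeA dot A (T \+ K) =
      num_range ip (fun u => Tt u + diag_op ip s u).
    rewrite -TKl; apply/seteqP; split=> [_ [x /= x1 <-]|_ [u u1 <-]].
      exists (image_elt S x); last first.
        by rewrite -TKx (image_elt_ip hdot A_closed S_sqrt ipE).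
      by rewrite -ipnormE -(normA_image_elt hdot A_closed S_sqrt ipE) x1 expr1n.
    exists (lift u) => /=; last first.
      by rewrite -(image_elt_ip hdot A_closed S_sqrt ipE) TKx -liftE.
    by rewrite (normA_image_elt hdot A_closed S_sqrt ipE) -liftE /ipnorm u1 sqrtr1.
  by apply/seteqP; split; [exact: clK|exact: subset_closure].
Qed.
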